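(* Let $X$ be a stable white noise with parameters $(\alpha,\beta,\sigma,\mu)$ and $X_0=\int_0^1X(t)\,dt$. Then for every $m(\cdot):\mathbb N\to\mathbb N$ with $\lim_{n\to\infty} m(n)/n^{1/\alpha}=\infty$, $$\lim_{n\to\infty}\sup_{m\ge m(n)}\left|\frac{\mathcal H_{m,n}(X)}{n}-\log\frac{m}{n^{1/\alpha}}-h(X_0)\right|=0,$$ where $h(X_0)$ is the differential entropy of the continuous random variable $X_0$.
   Context: A stable white noise with parameters $\alpha\in(0,2]$, $\beta\in[-1,1]$, $\sigma>0$, $\mu\in\mathbb R$ is the generalized random process $X$ on $\mathcal S'(\mathbb R)$ with $\mathbb E[e^{j\langle X,\varphi\rangle}]=\exp(\int_{\mathbb R}f(\varphi(t))dt)$, $f(\omega)=j\omega\mu-\sigma^\alpha|\omega|^\alpha(1-j\beta\,\mathrm{sgn}(\omega)\Phi(\omega))$, $\Phi(\omega)=\tan\frac{\pi\alpha}2$ if $\alpha\ne1$ and $\Phi(\omega)=-\frac2\pi\log|\omega|$ if $\alpha=1$. For $n\in\mathbb N$, $X_1^{(n)}=\int_0^{1/n}X(t)\,dt$ (increment of the associated Lévy process) and $X_0=\int_0^1X(t)dt$. $[x]_m=\frac1m\lfloor\frac12+mx\rfloor$, $\mathcal H_{m,n}(X)=n\,H([X_1^{(n)}]_m)$ with $H$ discrete entropy (natural log). *)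

(* Defs.v *)
From HB Require Import structures.
From mathcomp Require Import all_boot all_order all_algebra.
From mathcomp Require Import all_classical all_reals all_analysis.
Set Implicit Arguments. Unset Strict Implicit. Unset Printing Implicit Defensive.
Import Order.TTheory GRing.Theory Num.Theory.
Import numFieldNormedType.Exports.
Local Open Scope classical_set_scope.
Local Open Scope ring_scope.

Section Defs.
Context {R : realType}.

Definition stable_Phi (alpha omega : R) : R :=
  if alpha == 1 then - (2 / pi) * ln `|omega| else tan (pi * alpha / 2).

(* f(omega) = j omega mu - sigma^alpha |omega|^alpha (1 - j beta sgn(omega) Phi(omega)),
   split into real and imaginary parts *)
Definition stable_f_re (alpha sigma omega : R) : R :=
  - (sigma `^ alpha) * (`|omega| `^ alpha).
Definition stable_f_im (alpha beta sigma mu omega : R) : R :=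
  omega * mu + (sigma `^ alpha) * (`|omega| `^ alpha) * beta * Num.sg omega
               * stable_Phi alpha omega.

(* E[exp(j omega Y)] = exp(t f(omega)) for every omega, written componentwise
   (real part: E[cos(omega Y)], imaginary part: E[sin(omega Y)]). *)
Definition has_cf_exp d (T : measurableType d) (P : probability T R)
  (Y : T -> R) (t alpha beta sigma mu : R) : Prop :=
  forall omega : R,
    (\int[P]_w (cos (omega * Y w))%:E =
       (expR (t * stable_f_re alpha sigma omega)
        * cos (t * stable_f_im alpha beta sigma mu omega))%:E)%E /\
    (\int[P]_w (sin (omega * Y w))%:E =
       (expR (t * stable_f_re alpha sigma omega)
        * sin (t * stable_f_im alpha beta sigma mu omega))%:E)%E.

Definition quantize (m : nat) (x : R) : R :=
  (Num.floor (2^-1 + m%:R * x))%:~R / m%:R.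

(* discrete (Shannon) entropy, natural log, of a discrete random variable Y:
   H(Y) = sum_y - P(Y = y) log P(Y = y)  (a sum of nonnegative terms, possibly +oo) *)
Definition discrete_entropy d (T : measurableType d) (P : probability T R)
  (Y : T -> R) : \bar R :=
  (\esum_(y in [set: R])
     (let p := fine (P (Y @^-1` [set y])) in (- (p * ln p))%:E))%E.

Definition Hmn d (T : measurableType d) (P : probability T R)
  (X1n : T -> R) (m n : nat) : \bar R :=
  (n%:R%:E * discrete_entropy P (fun w => quantize m (X1n w)))%E.

Definition is_density d (T : measurableType d) (P : probability T R)
  (Y : T -> R) (g : R -> R) : Prop :=
  measurable_fun [set: R] g /\ (forall x, 0 <= g x) /\
  forall A : set R, measurable A ->
    P (Y @^-1` A) = (\int[lebesgue_measure]_(x in A) (g x)%:E)%E.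

(* differential entropy h = - int g log g  (with 0 log 0 = 0) *)
Definition diff_entropy (g : R -> R) : R :=
  - Rintegral lebesgue_measure [set: R] (fun x => g x * ln (g x)).

End Defs.

(* Main.v *)
Require Import Defs.
From HB Require Import structures.
From mathcomp Require Import all_boot all_order all_algebra.
From mathcomp Require Import all_classical all_reals all_analysis.
From mathcomp Require Import measurable_realfun ring lra.
Set Implicit Arguments.
Unset Strict Implicit.
Unset Printing Implicit Defensive.
Import Order.TTheory GRing.Theory Num.Theory.
Import numFieldNormedType.Exports.
Local Open Scope classical_set_scope.
Local Open Scope ring_scope.

(* The characteristic function of a stable law is [rho(t) e^(i theta(t))] with
   [rho] decaying faster than any power, so Fourier inversion, regularised by
   the Poisson kernel, gives [X0] a bounded Lipschitz density [g]. By scaling,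
   [n^(1/alpha) X1(n)] has the same density up to a deterministic shift, and
   quantizing [X1(n)] with step [1/m] amounts to cutting the line into cells of
   width [D = n^(1/alpha) / m], at some offset. The entropy of the resulting
   cell masses is [h(g_D) - ln D], where [g_D] is [g] averaged over each cell,
   and it remains to prove that [h(g_D) -> h(g)] as [D -> 0], uniformly in the
   offset. Gibbs' inequality on each cell yields [h(g_D) >= h(g)]. For the upper
   bound, Fatou's lemma is applied to the densities of relative entropy with
   respect to the Cauchy weight [1 / (1 + x^2)]: as [ln (1 + x^2)] is
   1-Lipschitz, averaging moves its mean by at most [D]. That mean is finite
   since [1 - Re phi(t)] is [O(t^r)] for some [r > 0] near [0], where [phi] is
   the characteristic function of [X0], and [ln (1 + x^2)] is dominated by a
   series in [1 - cos (x / 2^n)]. *)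

(** * Limits and integrals *)

Section limits.
Context {R : realType}.

Lemma near_limn_einf (u : (\bar R)^nat) (a : \bar R) : (a < limn_einf u)%E ->
  \forall n \near \oo, (a < u n)%E.
Proof.
rewrite limn_einf_lim (cvg_lim (@ereal_hausdorff R) (@cvg_einfs_sup _ u)).
move=> /ereal_sup_gt[_ [N _ <-] a_lt]; exists N => // n /= Nn.
by apply: (lt_le_trans a_lt); apply: ereal_inf_lbound; exists n.
Qed.

Lemma cvg_ereal_sup0 (A : nat -> set \bar R) :
  (forall n x, A n x -> (0 <= x)%E) -> (forall n, A n !=set0) ->
  (forall e : R, 0 < e ->
    \forall n \near \oo, forall x, A n x -> (x <= e%:E)%E) ->
  ereal_sup (A n) @[n --> \oo] --> 0%E.
Proof.
move=> A0 An0 A_le.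
have sup_ge0 n : (0 <= ereal_sup (A n))%E.
  by have [x Ax] := An0 n; exact: le_trans (A0 _ _ Ax) (ereal_sup_ubound Ax).
have sup_le (e : R) : 0 < e -> \forall n \near \oo, (ereal_sup (A n) <= e%:E)%E.
  by move=> /A_le; apply: filterS => n An_le; exact: ge_ereal_sup.
have sup_fin (e : R) n :
    (ereal_sup (A n) <= e%:E)%E -> ereal_sup (A n) \is a fin_num.
  by move=> ?; rewrite ge0_fin_numE// (le_lt_trans _ (ltry e)).
apply/fine_cvgP; split.
  by apply: filterS (sup_le 1 ltr01) => n; exact: sup_fin.
apply/cvgrPdist_le => /= e e0; apply: filterS (sup_le e e0) => n An_le.
by rewrite sub0r normrN ger0_norm ?fine_ge0// -lee_fin fineK// (sup_fin e).
Qed.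

Lemma nneseries_geometric_lty (u : nat -> \bar R) (a q : R) :
  0 <= a -> 0 < q < 1 ->
  (forall n, 0 <= u n <= (a * q ^+ n)%:E)%E -> (\sum_(n <oo) u n < +oo)%E.
Proof.
move=> a0 /andP[q0 q1] u_le; have u0 n : (0 <= u n)%E by have /andP[] := u_le n.
have q_norm : `|q| < 1 by rewrite gtr0_norm.
apply: (@le_lt_trans _ _ (a / (1 - q))%:E); last exact: ltry.
apply: lime_le; first by apply: is_cvg_nneseries.
apply: nearW => N.
apply: (@le_trans _ _ (series (geometric a q) N)%:E); last first.
  by rewrite lee_fin (geometric_le_lim N a0 q0 q_norm).
rewrite /series/geometric/= -sumEFin.
by apply: lee_sum => n _; have /andP[] := u_le n.
Qed.

Lemma near_divr_natr_le (N : nat -> R) (mf : nat -> nat)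
    (delta : R) : (\forall n \near \oo, 0 < N n) ->
  (mf n)%:R / N n @[n --> \oo] --> +oo -> 0 < delta ->
  \forall n \near \oo, forall m, (mf n <= m)%N ->
    (0 < m)%N /\ N n / m%:R <= delta.
Proof.
move=> N_gt0 /cvgryPge/(_ delta^-1) mf_large delta_gt0.
apply: filterS2 N_gt0 mf_large => n N0 mfN m mfm.
have mN : delta^-1 <= m%:R / N n.
  by rewrite (le_trans mfN)// ler_wpM2r ?invr_ge0 ?(ltW N0)// ler_nat.
have mN_gt0 : 0 < m%:R / N n by apply: lt_le_trans mN; rewrite invr_gt0.
split; first by move: mN_gt0; rewrite pmulr_lgt0 ?invr_gt0// ltr0n.
by rewrite -invf_div -[leRHS]invrK lef_pV2 ?posrE ?invr_gt0.
Qed.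

End limits.

Section Rintegral.
Context {d : measure_display} {T : measurableType d} {R : realType}
  (mu : {measure set T -> \bar R}).

Lemma EFin_Rintegral (A : set T) (f : T -> R) : measurable A ->
  mu.-integrable A (EFin \o f) ->
  ((\int[mu]_(x in A) f x)%:E = \int[mu]_(x in A) (f x)%:E)%E.
Proof.
by move=> mA fi; rewrite /Rintegral fineK//; exact: integrable_fin_num.
Qed.

End Rintegral.

Section finite_measure.
Context {d : measure_display} {T : measurableType d} {R : realType}
  (mu : {finite_measure set T -> \bar R}).
Implicit Types f : T -> R.

Lemma bounded_integrable f (K : R) : measurable_fun [set: T] f ->
  (forall w, `|f w| <= K) -> mu.-integrable [set: T] (fun w => (f w)%:E).
Proof.
move=> mf fK; apply: (@measurable_bounded_integrable _ _ _ mu f) => //.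
  by rewrite ltey_eq fin_num_measure.
exists K; split; first exact: num_real.
by move=> M KM w _ /=; exact: le_trans (fK w) (ltW KM).
Qed.

Lemma integrable_cos f : measurable_fun [set: T] f ->
  mu.-integrable [set: T] (fun w => (cos (f w))%:E).
Proof.
move=> mf; apply: (bounded_integrable (K := 1)) => [|w]; last exact: cos_max.
exact: (measurableT_comp (continuous_measurable_fun (@continuous_cos R))).
Qed.

Lemma integrable_sin f : measurable_fun [set: T] f ->
  mu.-integrable [set: T] (fun w => (sin (f w))%:E).
Proof.
move=> mf; apply: (bounded_integrable (K := 1)) => [|w]; last exact: sin_max.
exact: (measurableT_comp (continuous_measurable_fun (@continuous_sin R))).
Qed.

End finite_measure.

Section tonelli_subdomain.
Context {d1 d2 : measure_display} {T1 : measurableType d1}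
  {T2 : measurableType d2} {R : realType}.
Context (m1 : {sigma_finite_measure set T1 -> \bar R})
  (m2 : {sigma_finite_measure set T2 -> \bar R}).
Local Open Scope ereal_scope.

Lemma fubini_tonelli_sub (D : set T2) (f : T1 * T2 -> \bar R) :
  measurable D -> measurable_fun [set: T1 * T2] f -> (forall z, 0 <= f z) ->
  \int[m1]_x \int[m2]_(y in D) f (x, y) = \int[m2]_(y in D) \int[m1]_x f (x, y).
Proof.
move=> mD mf f0; pose h := f \_ (setT `*` D).
have hE x y : h (x, y) = ((fun z => f (x, z)) \_ D) y.
  by rewrite /h !patchE in_setX in_setT.
have mh : measurable_fun [set: T1 * T2] h.
  apply/(measurable_restrictT f); first exact: measurableX.
  exact: measurable_funTS.
have h0 z : 0 <= h z by rewrite /h patchE; case: ifPn.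
transitivity (\int[m1]_x \int[m2]_y h (x, y)).
  by apply: eq_integral => x _; rewrite integral_mkcond; apply: eq_integral.
rewrite (fubini_tonelli h mh h0) [RHS]integral_mkcond.
apply: eq_integral => y _; rewrite patchE; case: ifPn => yD.
  by apply: eq_integral => x _; rewrite hE patchE yD.
by apply: integral0_eq => x _; rewrite hE patchE (negbTE yD).
Qed.

End tonelli_subdomain.

Section countable_partition.
Context {d : measure_display} {T : measurableType d} {R : realType}
  (mu : {measure set T -> \bar R}).
Local Open Scope ereal_scope.

Lemma ge0_integral_countable_bigcup (I : countType) (F : I -> set T)
    (f : T -> \bar R) :
  (forall i, measurable (F i)) -> trivIset [set: I] F ->
  \bigcup_i F i = [set: T] ->
  measurable_fun [set: T] f -> (forall x, 0 <= f x) ->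
  \int[mu]_x f x = \esum_(i in [set: I]) \int[mu]_(x in F i) f x.
Proof.
move=> mF tF FT mf f0; pose G n := \bigcup_(i in [set i | pickle i = n]) F i.
have GE i : G (pickle i) = F i.
  apply/seteqP; split=> [x [j /= /(pcan_inj pickleK) ->]//|x Fx].
  by exists i.
have G0 n : n \notin range (@pickle I) -> G n = set0.
  move=> /negP nI; apply/seteqP; split=> // x [i /= iE _].
  by apply: nI; rewrite inE; exists i.
have GP n : (exists i : I, n = pickle i) \/ G n = set0.
  have [|/G0] := boolP (n \in range (@pickle I)); last by right.
  by rewrite inE => -[i _ <-]; left; exists i.
have mG n : measurable (G n) by have [[i ->]|->] := GP n; rewrite ?GE.
have tG : trivIset [set: nat] G.
  move=> m n _ _ [x [[i /= <- Fix] [j /= <- Fjx]]].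
  by congr pickle; apply: tF => //; exists x.
have GT : \bigcup_n G n = [set: T].
  rewrite -FT; apply/seteqP; split=> x [i _].
    by move=> [j _ Fjx]; exists j.
  by move=> Fix; exists (pickle i) => //; rewrite GE.
rewrite -GT ge0_integral_bigcup ?GT// nneseries_esumT; last first.
  by move=> n; exact: integral_ge0.
rewrite (esumID (range (@pickle I))); last by move=> n _; exact: integral_ge0.
rewrite setTI [X in _ + X]esum1 ?adde0; last first.
  by move=> n [_ /= nI]; rewrite G0 ?integral_set0//; apply/negP; rewrite inE.
rewrite esum_image; last by move=> i j _ _; exact: (pcan_inj pickleK).
by apply: eq_esum => i _; rewrite GE.
Qed.

End countable_partition.

(** * Real functions *)

Section klipschitz.
Context {R : realFieldType} {V W : normedModType R}.
Implicit Types (f : V -> W) (k : R).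

Lemma klipschitzP f k :
  k.-lipschitz f <-> forall x y, `|f x - f y| <= k * `|x - y|.
Proof. by split=> [fk x y|fk [x y] _]; [exact: (fk (x, y))|exact: fk]. Qed.

Lemma klipschitz_continuous f k : k.-lipschitz f -> continuous f.
Proof.
move=> /klipschitzP fk x; apply/cvgrPdist_le => /= e e0.
near=> y; rewrite (le_trans (fk x y))//.
rewrite (@le_trans _ _ ((`|k| + 1) * `|x - y|))//.
  by rewrite ler_wpM2r// (le_trans (ler_norm _))// lerDl.
rewrite mulrC -ler_pdivlMr//; near: y.
have xx : y @[y --> x] --> x by exact: cvg_id.
by move/cvgrPdist_le : xx; apply; rewrite divr_gt0.
Unshelve. all: by end_near. Qed.

End klipschitz.

Section real_klipschitz.
Context {R : realType}.
Implicit Types (f df : R -> R) (k x : R).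

Lemma is_derive_continuous f df :
  (forall x, is_derive x 1 f (df x)) -> continuous f.
Proof.
move=> dfE x; apply: differentiable_continuous; apply/derivable1_diffP.
by have [] := dfE x.
Qed.

Lemma klipschitz_ge0 f k : k.-lipschitz f -> 0 <= k.
Proof.
move=> /klipschitzP fk; have := le_trans (normr_ge0 _) (fk 1 0).
by rewrite subr0 normr1 mulr1.
Qed.

Lemma is_derive_klipschitz f df k : (forall x, is_derive x 1 f (df x)) ->
  (forall x, `|df x| <= k) -> k.-lipschitz f.
Proof.
move=> dfE dfk; apply/klipschitzP => x y; wlog xy : x y / y <= x.
  move=> ih; have [/ih//|/ltW/ih] := leP y x.
  by rewrite distrC [`|y - x|]distrC.
have [|c _ ->] := MVT_segment xy (fun z _ => dfE z).
  exact/continuous_subspaceT/(is_derive_continuous dfE).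
by rewrite normrM ler_wpM2r.
Qed.

Lemma cos_lipschitz : 1.-lipschitz (@cos R).
Proof.
apply: (is_derive_klipschitz (df := fun x => - sin x)) => x.
by rewrite normrN sin_max.
Qed.

End real_klipschitz.

Section oneDsqr.
Context {R : realType}.
Local Notation mu := (@lebesgue_measure R).
Implicit Types x : R.

Lemma oneDsqr_gt0 x : 0 < oneDsqr x.
Proof. exact: lt_le_trans ltr01 (oneDsqr_ge1 x). Qed.

Lemma ln_oneDsqr_ge0 x : 0 <= ln (oneDsqr x).
Proof. exact/ln_ge0/oneDsqr_ge1. Qed.

Lemma is_derive_ln_oneDsqr x :
  is_derive x 1 (fun z => ln (oneDsqr z)) (2 * x / oneDsqr x).
Proof.
have dsqr : is_derive x 1 (@oneDsqr R) (2 * x).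
  rewrite /oneDsqr; apply: is_derive_eq.
  by rewrite add0r /GRing.scale/=; ring.
have dln := is_derive1_ln (oneDsqr_gt0 x).
apply: (@is_derive_eq _ _ _ _ _ _ _ _ (is_derive1_comp dln dsqr)).
by rewrite mulrC.
Qed.

Lemma ln_oneDsqr_lipschitz : 1.-lipschitz (fun x => ln (oneDsqr x)).
Proof.
apply: (is_derive_klipschitz is_derive_ln_oneDsqr) => x.
rewrite normrM normfV (gtr0_norm (oneDsqr_gt0 x)) ler_pdivrMr ?oneDsqr_gt0//.
rewrite mul1r ler_norml /oneDsqr.
by have := sqr_ge0 (x + 1); have := sqr_ge0 (x - 1); nra.
Qed.

Lemma measurable_ln_oneDsqr : measurable_fun [set: R] (fun x => ln (oneDsqr x)).
Proof.
exact: continuous_measurable_fun (klipschitz_continuous ln_oneDsqr_lipschitz).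
Qed.

Lemma integrable_oneDsqrV :
  mu.-integrable [set: R] (EFin \o (fun x => (oneDsqr x)^-1)).
Proof.
apply/integrableP; split.
  apply/measurable_EFinP.
  exact: continuous_measurable_fun continuous_oneDsqrV.
under eq_integral do rewrite /= ger0_norm//.
rewrite ge0_symfun_integralT//.
- by rewrite -set_itvcy integral0y_oneDsqr -EFinM ltry.
- exact: continuous_oneDsqrV.
- by move=> x; rewrite /= /oneDsqr sqrrN.
Qed.

End oneDsqr.

Section sign.
Context {R : realType}.
Implicit Types a b c x y : R.

Lemma measurable_sgr : measurable_fun [set: R] (@Num.sg R).
Proof.
have -> : @Num.sg R =
    \1_(`]0, +oo[%classic : set R) \- \1_(`]-oo, 0[%classic : set R).
  apply/funext => x; rewrite /= !indicE !mem_setE !in_itv/= andbT.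
  by case: sgrP; rewrite ?(subr0, sub0r, subrr).
by apply: measurable_funB; apply: measurable_indic; exact: measurable_itv.
Qed.

Lemma sgr_le x y : x <= y -> Num.sg x <= Num.sg y.
Proof. by case: (sgrP x); case: (sgrP y) => //; lra. Qed.

Lemma sgrB_itv a b y : a < b -> y != a -> y != b ->
  Num.sg (b - y) - Num.sg (a - y) = 2 * \1_(`]a, b]%classic : set R) y.
Proof.
move=> ab ya yb; rewrite indicE mem_setE in_itv/=.
by case: (sgrP (b - y)); case: (sgrP (a - y));
  case: (ltP a y); case: (leP y b) => //=; lra.
Qed.

Lemma cvg_atan_sgr c :
  atan (c / n.+1%:R^-1) @[n --> \oo] --> (pi / 2 * Num.sg c : R).
Proof.
have cvgp c' : 0 < c' -> atan (c' / n.+1%:R^-1) @[n --> \oo] --> (pi / 2 : R).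
  move=> c0.
  apply: (cvg_comp (fun n : nat => c' / n.+1%:R^-1) (@atan R) _ (@cvgy_atan R)).
  under eq_fun do rewrite invrK.
  apply: (cvg_comp (fun n : nat => n.+1%:R) (fun z : R => c' * z))
    (gt0_cvgMry c0 cvg_id).
  have := (@cvgr_idn R).
  by rewrite -(cvg_shiftn 1); under eq_fun do rewrite addn1.
have [->|c0|c0] := sgrP c.
- by rewrite mulr0; under eq_fun do rewrite mul0r atan0; exact: cvg_cst.
- by rewrite mulr1; exact: cvgp.
- have := cvgp (- c); rewrite oppr_gt0 => /(_ c0) /cvgN; rewrite mulrN1.
  apply: cvg_trans; apply: near_eq_cvg; apply: nearW => n.
  by rewrite /= fctE mulNr atanN opprK.
Qed.

End sign.

Section gibbs.
Context {R : realType}.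
Implicit Types t u x : R.

Lemma ln_leB1 x : 0 < x -> ln x <= x - 1.
Proof.
move=> x0; have := @le_ln1Dx _ (x - 1); rewrite (_ : 1 + (x - 1) = x);
  last by ring.
by apply; lra.
Qed.

Lemma gibbs t u : 0 <= t -> 0 < u -> t * ln u - t * ln t <= u - t.
Proof.
move=> t0 u0; have [->|tn0] := eqVneq t 0; first by rewrite !mul0r; lra.
have tp : 0 < t by rewrite lt0r tn0.
rewrite -mulrBr -ln_div ?posrE//.
have -> : u - t = t * (u / t - 1) by field.
by rewrite ler_wpM2l// ln_leB1// divr_gt0.
Qed.

Lemma xlnx_le_sqrt x : 0 <= x <= 1 -> `|x * ln x| <= 2 * Num.sqrt x.
Proof.
move=> /andP[]; rewrite le_eqVlt => /predU1P[<- _|x0 x1].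
  by rewrite mul0r normr0 mulr_ge0 ?sqrtr_ge0.
set s := Num.sqrt x; have s0 : 0 < s by rewrite sqrtr_gt0.
have xE : x = s ^+ 2 by rewrite sqr_sqrtr// ltW.
have s_le1 : s <= 1 by rewrite -sqrtr1 ler_sqrt.
have sV0 : 0 < s^-1 by rewrite invr_gt0.
have lns0 : ln s <= 0 by exact: ln_le0.
rewrite xE lnXn// normrM ger0_norm ?sqr_ge0// ler0_norm; last first.
  by rewrite mulrn_wle0.
have : s * (- ln s) <= 1.
  rewrite -lnV ?posrE// -ler_pdivlMl// mulr1.
  exact: ltW (ln_sublinear sV0).
by have := s0; nra.
Qed.

Lemma cvg_xlnx (u : nat -> R) t : (forall n, 0 <= u n) -> 0 <= t ->
  u n @[n --> \oo] --> t -> u n * ln (u n) @[n --> \oo] --> t * ln t.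
Proof.
move=> u0; rewrite le_eqVlt => /predU1P[<-|t0] ut; last first.
  by apply: cvgM => //; apply: continuous_cvg => //; exact: continuous_ln.
rewrite mul0r; apply: norm_cvg0.
apply: (@squeeze_cvgr _ _ _ _ (cst 0) (fun n => 2 * Num.sqrt (u n))).
- have /cvgr_le /(_ 1 ltr01) := ut; apply: filterS => n un1.
  by rewrite normr_ge0 xlnx_le_sqrt// u0.
- exact: cvg_cst.
- rewrite -[0 in X in _ --> X](mulr0 2) -[0 in X in 2 * X](@sqrtr0 R).
  by apply: cvgMl_tmp; apply: continuous_cvg => //; exact: sqrt_continuous.
Qed.

End gibbs.

Section powR_exponential.
Context {R : realType}.
Implicit Types a s t : R.

Lemma exprn_powR_ge (a t : R) (N k : nat) : 0 <= t -> k%:R <= a * N%:R ->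
  t ^+ k <= 1 + (t `^ a) ^+ N.
Proof.
move=> t0 kN; have tN0 : 0 <= (t `^ a) ^+ N by rewrite exprn_ge0 ?powR_ge0.
have [t1|/ltW t1] := leP t 1.
  by rewrite (le_trans (exprn_ile1 _ t0 t1))// lerDl.
apply: (@le_trans _ _ ((t `^ a) ^+ N)); last by rewrite lerDr.
by rewrite -!powR_mulrn ?powR_ge0// -powRrM ler_powR.
Qed.

Lemma exprn_expRN_le s y (N : nat) : 0 < s -> 0 <= y ->
  y ^+ N * expR (- (s * y)) <= N`!%:R / s ^+ N.
Proof.
move=> s0 y0; have sN0 : 0 < s ^+ N by rewrite exprn_gt0.
have exp_ge : (s * y) ^+ N / N`!%:R <= expR (s * y).
  case: N {sN0} => [|N].
    by rewrite expr0 fact0 invr1 mulr1 -expR0 ler_expR mulr_ge0// ltW.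
  have := @expR_ge1Dxn _ (s * y) N (mulr_ge0 (ltW s0) y0).
  by apply: le_trans; rewrite lerDr.
rewrite expRN ler_pdivrMr ?expR_gt0//.
have -> : y ^+ N = N`!%:R / s ^+ N * ((s * y) ^+ N / N`!%:R).
  by rewrite exprMn; field; rewrite expf_neq0 ?gt_eqF//
    pnatr_eq0 -lt0n fact_gt0.
by rewrite ler_wpM2l// divr_ge0// ltW.
Qed.

Lemma powR_exponential_decay s a : 0 < s -> 0 < a -> exists2 K : R, 0 <= K &
  forall t, 0 <= t -> (1 + t) ^+ 3 * expR (- (s * t `^ a)) <= K.
Proof.
move=> s0 a0; pose N := (Num.truncn (3 / a)).+1.
have aN : 3 <= a * N%:R.
  rewrite mulrC -ler_pdivrMr// ltW//.
  by have /andP[] := truncn_itv (ltW (divr_gt0 (ltr0n R 3) a0)).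
have KN0 : 0 <= N`!%:R / s ^+ N by rewrite divr_ge0// exprn_ge0// ltW.
exists (4 * (2 + N`!%:R / s ^+ N)) => [|t t0].
  by rewrite mulr_ge0// addr_ge0.
have exp_le1 : expR (- (s * t `^ a)) <= 1.
  by rewrite -expR0 ler_expR oppr_le0 mulr_ge0 ?powR_ge0// ltW.
have exp_ge0 := expR_ge0 (- (s * t `^ a)).
have cube_le : (1 + t) ^+ 3 <= 4 * (2 + (t `^ a) ^+ N).
  have := exprn_powR_ge t0 aN.
  by have := mulr_ge0 (addr_ge0 ler01 t0) (sqr_ge0 (1 - t)); lra.
rewrite (le_trans (ler_wpM2r exp_ge0 cube_le))//.
rewrite -mulrA ler_wpM2l// mulrDl lerD//.
  by rewrite ler_piMr.
by rewrite exprn_expRN_le ?powR_ge0.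
Qed.

End powR_exponential.

Section dyadic_scale.
Context {R : realType}.
Implicit Types s x : R.

Lemma dyadic_scale x : 1 <= x -> exists n : nat, 2 ^+ n <= x < 2 ^+ n.+1.
Proof.
move=> x1; have /andP[trunc_le lt_trunc] := truncn_itv (le_trans ler01 x1).
have trunc_gt0 : (0 < Num.truncn x)%N by rewrite truncn_gt0.
have /andP[log_le lt_log] := trunc_log_bounds (isT : (1 < 2)%N) trunc_gt0.
exists (trunc_log 2 (Num.truncn x)); rewrite -!natrX; apply/andP; split.
  by apply: le_trans trunc_le; rewrite ler_nat.
by apply: (lt_le_trans lt_trunc); rewrite ler_nat.
Qed.

Lemma cos1_lt1 : cos 1 < 1 :> R.
Proof.
have pi2 := pi_ge2 R.
by rewrite -[ltRHS]cos0 ltr_cos ?in_itv/= ?lexx ?pi_ge0//; lra.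
Qed.

Lemma cos_le_cos1 x : 1 <= `|x| <= 2 -> cos x <= cos 1.
Proof.
rewrite le_eqVlt -[cos x]cos_norm => /andP[/predU1P[<-//|x1] x2].
by apply: ltW; rewrite ltr_cos ?in_itv//=; have := pi_ge2 R; lra.
Qed.

Lemma bernoulli_natrM_le s n : 1 <= s <= 2 -> n.+1%:R * (s - 1) <= s ^+ n.
Proof.
move=> /andP[s1 s2]; elim: n => [|n IHn]; first by rewrite expr0 mul1r; lra.
rewrite exprS -natr1 mulrDl mul1r.
have : 1 <= s ^+ n by rewrite exprn_ege1.
nra.
Qed.

Lemma ln_oneDsqr_dyadic_le x n : 2 ^+ n <= `|x| < 2 ^+ n.+1 ->
  ln (oneDsqr x) <= 6 * n.+1%:R.
Proof.
move=> /andP[_ xn].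
have x4 : x ^+ 2 <= 4 ^+ n.+1.
  rewrite -real_normK ?num_real// (_ : 4 = 2 ^+ 2); last by rewrite -natrX.
  by rewrite -exprM mulnC exprM lerXn2r ?nnegrE// ltW.
have oneDsqr_le : oneDsqr x <= 4 ^+ n.+2.
  have : (1 : R) <= 4 ^+ n.+1 by rewrite exprn_ege1// ler1n.
  by rewrite /oneDsqr (exprS _ n.+1); lra.
have ln4 : ln (4 : R) <= 3 by rewrite (le_trans (ln_leB1 _))//; lra.
have n0 : (0 : R) <= n%:R by [].
rewrite (@le_trans _ _ (ln (4 ^+ n.+2)))//.
  by rewrite ler_ln ?posrE ?oneDsqr_gt0 ?exprn_gt0.
rewrite lnXn// -[X in X <= _]mulr_natr (@le_trans _ _ (3 * n.+2%:R))//.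
  by rewrite ler_wpM2r.
by rewrite -natr1 -[n.+1%:R]natr1; lra.
Qed.

(* The term of the dyadic scale of [x] alone dominates the logarithm. *)
Lemma ln_oneDsqr_le_series s : 1 < s <= 2 -> exists2 K : R, 0 <= K &
  forall x, ((ln (oneDsqr x))%:E <=
    1 + \sum_(n <oo) (K * s ^+ n * (1 - cos ((2 ^+ n)^-1 * x)))%:E)%E.
Proof.
move=> /andP[s1 s2]; pose K : R := 6 / ((s - 1) * (1 - cos 1)).
have c1 : 0 < 1 - cos 1 :> R by rewrite subr_gt0 cos1_lt1.
have sB1 : 0 < s - 1 by rewrite subr_gt0.
have K0 : 0 <= K by rewrite divr_ge0// mulr_ge0// ltW.
exists K => // x.
have term_ge0 n : (0 <= (K * s ^+ n * (1 - cos ((2 ^+ n)^-1 * x)))%:E)%E.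
  rewrite lee_fin mulr_ge0 ?subr_ge0 ?cos_le1// mulr_ge0// exprn_ge0//.
  by rewrite ltW// (lt_trans ltr01).
have [x1|/dyadic_scale[n nx]] := ltP `|x| 1.
  apply: (@le_trans _ _ 1%E); last by rewrite leeDl//; exact: nneseries_ge0.
  rewrite lee_fin (le_trans (ln_leB1 (oneDsqr_gt0 x)))// /oneDsqr addrC addKr.
  by rewrite -real_normK ?num_real// exprn_ile1// ltW.
apply: (@le_trans _ _
  (K * s ^+ n * (1 - cos ((2 ^+ n)^-1 * x)))%:E); last first.
  rewrite (@nneseriesD1 _ _ n)// -[leLHS]add0e leeD// leeDl//.
  exact: nneseries_ge0.
rewrite lee_fin (le_trans (ln_oneDsqr_dyadic_le nx))//.
have cos_le : 1 - cos 1 <= 1 - cos ((2 ^+ n)^-1 * x).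
  rewrite lerD2l lerN2 cos_le_cos1// normrM gtr0_norm ?invr_gt0 ?exprn_gt0//.
  have /andP[nx1 nx2] := nx.
  by rewrite ler_pdivlMl ?exprn_gt0// mulr1 nx1 ler_pdivrMl ?exprn_gt0//
    mulrC -exprS ltW.
have s_le : n.+1%:R * (s - 1) <= s ^+ n.
  by apply: bernoulli_natrM_le; rewrite (ltW s1).
have -> : 6 * n.+1%:R = K * (n.+1%:R * (s - 1)) * (1 - cos 1).
  by rewrite /K; field; rewrite !gt_eqF.
apply: ler_pM => //; last exact: ler_wpM2l.
exact: mulr_ge0 K0 (mulr_ge0 (ler0n _ _) (ltW sB1)).
Qed.

End dyadic_scale.

(** * Fourier inversion *)

Section poisson_kernel.
Context {R : realType}.
Local Notation mu := (@lebesgue_measure R).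
Implicit Types e t x y a b : R.

Definition poisson_kernel e y : R := e / (e ^+ 2 + y ^+ 2).

Lemma poisson_kernel_ge0 e y : 0 <= e -> 0 <= poisson_kernel e y.
Proof. by move=> e0; rewrite divr_ge0// addr_ge0 ?sqr_ge0. Qed.

Lemma poisson_denom_gt0 e y : 0 < e -> 0 < e ^+ 2 + y ^+ 2.
Proof. by move=> e0; rewrite ltr_pwDl ?exprn_gt0 ?sqr_ge0. Qed.

Lemma continuous_poisson_kernel e : 0 < e -> continuous (poisson_kernel e).
Proof.
move=> e0 y; apply: cvgM; first exact: cvg_cst.
apply: cvgV; first by rewrite gt_eqF ?poisson_denom_gt0.
by apply: cvgD; [exact: cvg_cst|exact: exprn_continuous].
Qed.

Lemma continuous_expRN e : continuous (fun t => expR (- (e * t))).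
Proof.
move=> t; apply: continuous_comp; last exact: continuous_expR.
by apply: cvgN; apply: cvgM; [exact: cvg_cst|exact: cvg_id].
Qed.

Lemma measurable_expRN e A : measurable_fun A (fun t => expR (- (e * t))).
Proof.
apply: measurable_funTS.
exact: continuous_measurable_fun (@continuous_expRN e).
Qed.

Lemma cvgy_expRN e : 0 < e -> expR (- (e * t)) @[t --> +oo] --> (0 : R).
Proof.
move=> e0; apply: (cvg_comp (fun t => e * t) (fun z => expR (- z))).
  exact: (gt0_cvgMry e0 cvg_id).
exact: cvgr_expR.
Qed.

(* The summand [1] makes the integrand nonnegative, as the improper fundamental
   theorem of calculus requires. *)
Lemma integral_expRN_1Dcos e y : 0 < e ->
  (\int[mu]_(t in `[0%R, +oo[) (expR (- (e * t)) * (1 + cos (t * y)))%:E =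
   (e^-1 + poisson_kernel e y)%:E)%E.
Proof.
move=> e0; have D0 := poisson_denom_gt0 y e0.
pose F t := expR (- (e * t)) *
  (- e^-1 + (y * sin (t * y) - e * cos (t * y)) / (e ^+ 2 + y ^+ 2)).
have dF t : is_derive t 1 F (expR (- (e * t)) * (1 + cos (t * y))).
  apply: is_derive_eq; rewrite ?scaler0 ?add0r /GRing.scale/=.
  by field; rewrite !gt_eqF.
rewrite (@ge0_continuous_FTC2y _ _ F _ 0).
- rewrite /F /poisson_kernel mulr0 oppr0 expR0 mul0r sin0 cos0 -EFinB.
  by congr EFin; field; rewrite !gt_eqF.
- by move=> t _; rewrite mulr_ge0 ?expR_ge0// -lerBlDl sub0r cos_geN1.
- apply/continuous_subspaceT => t; apply: cvgM; first exact: continuous_expRN.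
  apply: cvgD; first exact: cvg_cst.
  apply: continuous_comp; last exact: continuous_cos.
  by apply: cvgM; [exact: cvg_id|exact: cvg_cst].
- pose K := e^-1 + (`|y| + e) / (e ^+ 2 + y ^+ 2).
  apply: norm_cvg0.
  apply: (@squeeze_cvgr _ _ _ _ (cst 0) (fun t => expR (- (e * t)) * K)).
  + apply: nearW => t; rewrite normr_ge0/= normrM ger0_norm ?expR_ge0//.
    rewrite ler_wpM2l ?expR_ge0// (le_trans (ler_normD _ _))// normrN.
    rewrite gtr0_norm ?invr_gt0// lerD2l normrM normfV (gtr0_norm D0).
    rewrite ler_wpM2r ?invr_ge0 ?(ltW D0)// (le_trans (ler_normB _ _))//.
    by rewrite !normrM (gtr0_norm e0) lerD// ler_piMr ?sin_max ?cos_max// ltW.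
  + exact: cvg_cst.
  + rewrite -[0 in X in _ --> X](mul0r K); apply: cvgMr_tmp.
    exact: cvgy_expRN.
- by move=> t _; have [] := dF t.
- exact/cvg_at_right_filter/(is_derive_continuous dF).
- by move=> t _; rewrite derive1E; have [] := dF t.
Qed.

Lemma integral_expRN e : 0 < e ->
  (\int[mu]_(t in `[0%R, +oo[) (expR (- (e * t)))%:E = (e^-1)%:E)%E.
Proof.
move=> e0; have := integral_expRN_1Dcos 0 e0.
under eq_integral do rewrite mulr0 cos0 mulrC EFinM.
rewrite ge0_integralZl//; last first.
  by apply/measurable_EFinP; exact: measurable_expRN.
move=> /(congr1 (fun z => (2^-1)%:E * z)%E); rewrite muleA -!EFinM.
rewrite [_ * (1 + 1)](_ : _ = 1) ?mul1e => [->|]; last by field.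
by congr EFin; rewrite /poisson_kernel; field; rewrite gt_eqF.
Qed.

Lemma integrable_expRN e : 0 < e ->
  mu.-integrable `[0%R, +oo[ (fun t => (expR (- (e * t)))%:E).
Proof.
move=> e0; apply/integrableP; split.
  by apply/measurable_EFinP; exact: measurable_expRN.
under eq_integral do rewrite gee0_abs ?lee_fin ?expR_ge0//.
by rewrite integral_expRN// ltry.
Qed.

Lemma is_derive_atan_poisson e y x : 0 < e ->
  is_derive x 1 (fun z => atan ((z - y) / e)) (poisson_kernel e (y - x)).
Proof.
move=> e0; pose h z := (z - y) / e.
have dh : is_derive x 1 h e^-1.
  by apply: is_derive_eq; rewrite ?scaler0 ?add0r /GRing.scale/=; ring.
apply: (@is_derive_eq _ _ _ _ _ _ _ _
  (is_derive1_comp (is_derive1_atan (h x)) dh)).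
by rewrite /h /poisson_kernel; field; rewrite !gt_eqF ?poisson_denom_gt0.
Qed.

Lemma integral_poisson_kernel e y a b : 0 < e -> a < b ->
  (\int[mu]_(x in `[a, b]) (poisson_kernel e (y - x))%:E =
   (atan ((b - y) / e) - atan ((a - y) / e))%:E)%E.
Proof.
move=> e0 ab; pose F x := atan ((x - y) / e).
have dF x : is_derive x 1 F (poisson_kernel e (y - x)).
  exact: is_derive_atan_poisson.
have cF := is_derive_continuous dF.
rewrite (@continuous_FTC2 _ _ F)//.
- apply/continuous_subspaceT => x.
  apply: (@continuous_comp _ _ _ (fun z => y - z) (poisson_kernel e)).
    by apply: cvgB; [exact: cvg_cst|exact: cvg_id].
  exact: continuous_poisson_kernel.
- split.
  + by move=> x _; have [] := dF x.
  + exact/cvg_at_right_filter/cF.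
  + exact/cvg_at_left_filter/cF.
- by move=> x _; rewrite derive1E; have [] := dF x.
Qed.

End poisson_kernel.

Section density_measure.
Context {R : realType} (g : R -> R).
Local Notation mu := (@lebesgue_measure R).

Definition density_measure (mg : measurable_fun [set: R] g)
    (g0 : forall x, 0 <= g x) (A : set R) : \bar R :=
  (\int[mu]_(x in A) (g x)%:E)%E.

Hypotheses (mg : measurable_fun [set: R] g) (g0 : forall x, 0 <= g x).

Let density_measure0 : density_measure mg g0 set0 = 0%E.
Proof. by rewrite /density_measure integral_set0. Qed.

Let density_measure_ge0 A : (0 <= density_measure mg g0 A)%E.
Proof. by apply: integral_ge0 => x _; rewrite lee_fin. Qed.

Let density_measure_sigma_additive :
  semi_sigma_additive (density_measure mg g0).
Proof.
move=> /= A mA tA mUA; rewrite /density_measure/= ge0_integral_bigcup//=.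
- apply: is_cvg_ereal_nneg_natsum_cond => n _ _.
  by apply: integral_ge0 => x _; rewrite lee_fin.
- by apply/measurable_EFinP; apply: measurable_funTS.
- by move=> x _; rewrite lee_fin.
Qed.

HB.instance Definition _ := isMeasure.Build default_measure_display R R
  (density_measure mg g0)
  density_measure0 density_measure_ge0 density_measure_sigma_additive.

End density_measure.

Section is_density.
Context {R : realType} {d : measure_display} {T : measurableType d}
  (P : probability T R).
Local Notation mu := (@lebesgue_measure R).
Implicit Types (Y : {RV P >-> R}) (g h : R -> R).

Lemma is_density_of_itv Y g :
  measurable_fun [set: R] g -> (forall x, 0 <= g x) ->
  (forall a b : R, (a < b)%R -> P (Y @^-1` `]a, b]) =
    \int[mu]_(x in `]a, b]) (g x)%:E)%E ->
  is_density P Y g.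
Proof.
move=> mg g0 gP; split => //; split => // A mA.
have -> : P (Y @^-1` A) = distribution P Y A by [].
apply: (@measure_unique _ R R (@ocitv R) (fun n => `](- n%:R), n%:R]%classic)
  _ _ _ _ (distribution P Y) (density_measure mg g0)) => //.
- exact: ocitvI.
- by move=> n; exact: is_ocitv.
- exact: bigcup_itvT.
- move=> _ [[a b] _ <-] /=; have [ab|ba] := ltP a b.
    by rewrite /distribution /pushforward gP.
  by rewrite set_itv_ge ?bnd_simp -?leNgt// !measure0.
- move=> n; apply: le_lt_trans (probability_le1 (distribution P Y) _) (ltry 1).
  exact: measurable_itv.
Qed.

Lemma integral_is_density Y g : is_density P Y g ->
  (\int[mu]_x (g x)%:E = 1)%E.
Proof. by move=> [_ [_ gP]]; rewrite -gP// preimage_setT probability_setT. Qed.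

Lemma integrable_is_density Y g : is_density P Y g ->
  mu.-integrable [set: R] (EFin \o g).
Proof.
move=> dY; have [mg [g0 _]] := dY; apply/integrableP; split.
  exact/measurable_EFinP.
by under eq_integral do rewrite /= ger0_norm//;
  rewrite (integral_is_density dY) ltry.
Qed.

Lemma ge0_integral_is_density Y g h : is_density P Y g ->
  measurable_fun [set: R] h -> (forall x, 0 <= h x) ->
  (\int[P]_w (h (Y w))%:E = \int[mu]_x (g x * h x)%:E)%E.
Proof.
move=> dY mh h0; have [mg [g0 gP]] := dY.
pose Y' : {RV P >-> measurableTypeR R} := HB.pack_for
  {mfun T >-> measurableTypeR R} (Y : T -> measurableTypeR R)
  (isMeasurableFun.Build _ _ _ (measurableTypeR R) Y
    (@measurable_funPT _ _ _ _ Y)).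
pose nu : {finite_measure set (measurableTypeR R) -> \bar R} :=
  distribution P Y'.
pose dnu := Radon_Nikodym_SigmaFinite.f nu mu.
have mhE : measurable_fun [set: R] (EFin \o h) by exact/measurable_EFinP.
have nuE A : measurable A -> (nu A = \int[mu]_(x in A) (g x)%:E)%E by exact: gP.
have numu : nu `<< mu.
  apply/null_content_dominatesP => A mA A0.
  rewrite nuE//; apply: null_set_integral => //.
  by apply/measurable_EFinP; exact: measurable_funTS.
have idnu : mu.-integrable [set: R] dnu.
  exact: Radon_Nikodym_SigmaFinite.f_integrable.
have dnu_g : ae_eq mu [set: R] dnu (EFin \o g).
  apply: integral_ae_eq => // [|A _ mA]; first exact/measurable_EFinP.
  by rewrite -nuE// /dnu -Radon_Nikodym_SigmaFinite.f_integral.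
transitivity (\int[nu]_x (h x)%:E)%E.
  by rewrite (ge0_integral_distribution Y').
rewrite -(Radon_Nikodym_SigmaFinite.change_of_variables numu)//.
apply: ae_eq_integral => //.
- by apply: emeasurable_funM => //; exact: measurable_int idnu.
- by apply/measurable_EFinP; exact: measurable_funM.
- apply: filterS dnu_g => x /(_ I) /= dnuE _.
  by rewrite -/dnu dnuE mulrC.
Qed.

End is_density.

Section polar_cf.
Context {R : realType} {d : measure_display} {T : measurableType d}
  (P : probability T R).
Implicit Types (Y : {RV P >-> R}) (rho theta : R -> R) (a b t : R).

(* The characteristic function of [Y] is [rho(t) e^(i theta(t))] on the
   half-line [t >= 0], which determines it. *)
Definition has_polar_cf (Y : T -> R) rho theta : Prop := forall t, 0 <= t ->
  (\int[P]_w (cos (t * Y w))%:E = (rho t * cos (theta t))%:E)%E /\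
  (\int[P]_w (sin (t * Y w))%:E = (rho t * sin (theta t))%:E)%E.

Lemma integral_probability_cst (r : R) : (\int[P]_w r%:E = r%:E)%E.
Proof. by rewrite integral_cst// [X in (_ * X)%E]probability_setT mule1. Qed.

Lemma integral_probability_affine (f : T -> R) (a b c : R) :
  P.-integrable [set: T] (fun w => (f w)%:E) -> (\int[P]_w (f w)%:E = c%:E)%E ->
  (\int[P]_w (a + b * f w)%:E = (a + b * c)%:E)%E.
Proof.
move=> fi fc; under eq_integral do rewrite EFinD EFinM.
rewrite integralD//; first by rewrite integral_probability_cst integralZl// fc.
  exact: finite_measure_integrable_cst.
exact: integrableZl.
Qed.

Lemma has_polar_cf_affine Y rho theta a b :
  0 <= a -> has_polar_cf Y rho theta ->
  has_polar_cf (fun w => a * Y w - b)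
    (fun t => rho (t * a)) (fun t => theta (t * a) - t * b).
Proof.
move=> a0 cfY t t0; have ta0 : 0 <= t * a by rewrite mulr_ge0.
have [cosY sinY] := cfY _ ta0.
have mtaY : measurable_fun [set: T] (fun w => t * a * Y w).
  exact: measurable_funM.
have [icos isin] := (integrable_cos P mtaY, integrable_sin P mtaY).
split.
- transitivity (\int[P]_w ((cos (t * b))%:E * (cos (t * a * Y w))%:E +
      (sin (t * b))%:E * (sin (t * a * Y w))%:E))%E.
    apply: eq_integral => w _; rewrite -!EFinM -EFinD; congr EFin.
    by rewrite mulrBr mulrA cosB; ring.
  rewrite integralD//; try exact: integrableZl.
  rewrite !integralZl// cosY sinY -!EFinM -EFinD; congr EFin.
  by rewrite cosB; ring.
- transitivity (\int[P]_w ((cos (t * b))%:E * (sin (t * a * Y w))%:E -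
      (sin (t * b))%:E * (cos (t * a * Y w))%:E))%E.
    apply: eq_integral => w _; rewrite -!EFinM -EFinB; congr EFin.
    by rewrite mulrBr mulrA sinB; ring.
  rewrite integralB//; try exact: integrableZl.
  rewrite !integralZl// cosY sinY -!EFinM -EFinB; congr EFin.
  by rewrite sinB; ring.
Qed.

End polar_cf.

Section oscillatory_integral.
Context {R : realType} (theta : R -> R).
Local Notation mu := (@lebesgue_measure R).
Local Notation D := (`[0%R, +oo[%classic : set R).
Hypothesis mtheta : measurable_fun D theta.
Let mD : (R.-ocitv.-measurable).-sigma.-measurable D.
Proof. exact: measurable_itv. Qed.
Implicit Types (q : R -> R) (e t x : R).

Definition osc_integral q x : R :=
  (\int[mu]_(t in D) (q t * cos (theta t - t * x)))%R.

Lemma integrable_osc q x : mu.-integrable D (EFin \o q) ->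
  mu.-integrable D (fun t => (q t * cos (theta t - t * x))%:E).
Proof.
move=> iq; apply: (le_integrable _ _ _ iq) => //.
  apply/measurable_EFinP/measurable_funM.
    by apply/measurable_EFinP; exact: measurable_int iq.
  apply: (measurableT_comp (continuous_measurable_fun (@continuous_cos R))).
  by apply: measurable_funB => //; exact: measurable_funM.
by move=> t _ /=; rewrite lee_fin normrM ler_piMr// cos_max.
Qed.

Lemma EFin_osc_integral q x : mu.-integrable D (EFin \o q) ->
  ((osc_integral q x)%:E =
   \int[mu]_(t in D) (q t * cos (theta t - t * x))%:E)%E.
Proof.
move=> iq; rewrite /osc_integral /Rintegral fineK//.
by apply: integrable_fin_num => //; exact: integrable_osc.
Qed.

Lemma osc_integral_bounded q x : mu.-integrable D (EFin \o q) ->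
  `|osc_integral q x| <= (\int[mu]_(t in D) `|q t|)%R.
Proof.
move=> iq; have iqx := integrable_osc x iq.
apply: (le_trans (le_normr_Rintegral _ iqx)) => //.
apply: le_Rintegral => //; [exact: integrable_norm..|] => t _ /=.
by rewrite normrM ler_piMr// cos_max.
Qed.

Lemma osc_integral_lipschitz q : mu.-integrable D (EFin \o q) ->
  mu.-integrable D (fun t => (t * q t)%:E) ->
  (\int[mu]_(t in D) `|t * q t|)%R.-lipschitz (osc_integral q).
Proof.
move=> iq itq; apply/klipschitzP => x y.
have [iqx iqy] := (integrable_osc x iq, integrable_osc y iq).
have iqxy := integrableB mD iqx iqy.
have intq := integrable_norm itq.
rewrite /osc_integral -RintegralB//.
apply: (le_trans (le_normr_Rintegral _ iqxy)) => //; rewrite -RintegralZr//.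
apply: le_Rintegral => //; first exact: integrable_norm.
  exact: (integrableZr mD `|x - y| intq).
move=> t; rewrite /= in_itv/= andbT => t0.
rewrite -mulrBr !normrM (mulrC `|t|) -mulrA ler_wpM2l// -normrM.
have /klipschitzP cos_dist := @cos_lipschitz R.
apply: (le_trans (cos_dist _ _)).
rewrite mul1r distrC.
by have -> : theta t - t * y - (theta t - t * x) = t * (x - y) by ring.
Qed.

Lemma continuous_osc_integral q : mu.-integrable D (EFin \o q) ->
  mu.-integrable D (fun t => (t * q t)%:E) -> continuous (osc_integral q).
Proof. by move=> *; exact/klipschitz_continuous/osc_integral_lipschitz. Qed.

Definition damped e q t : R := expR (- (e * t)) * q t.

Lemma damped_norm_le q e t : 0 <= e -> 0 <= t -> `|damped e q t| <= `|q t|.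
Proof.
move=> e0 t0; rewrite normrM ler_piMl// ger0_norm ?expR_ge0//.
by rewrite -expR0 ler_expR oppr_le0 mulr_ge0.
Qed.

Lemma integrable_damped q e : 0 <= e -> mu.-integrable D (EFin \o q) ->
  mu.-integrable D (EFin \o damped e q).
Proof.
move=> e0 iq; apply: (le_integrable _ _ _ iq) => //.
  apply/measurable_EFinP/measurable_funM; first exact: measurable_expRN.
  by apply/measurable_EFinP; exact: measurable_int iq.
by move=> t; rewrite /= in_itv/= andbT => t0; rewrite lee_fin damped_norm_le.
Qed.

Lemma osc_integral_damped_bounded q e x : 0 <= e ->
  mu.-integrable D (EFin \o q) ->
  `|osc_integral (damped e q) x| <= (\int[mu]_(t in D) `|q t|)%R.
Proof.
move=> e0 iq; have ieq := integrable_damped e0 iq.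
apply: (le_trans (osc_integral_bounded x ieq)).
apply: le_Rintegral => //; [exact: integrable_norm..|] => t.
by rewrite /= in_itv/= andbT => t0; exact: damped_norm_le.
Qed.

Lemma cvg_osc_integral_damped q x : mu.-integrable D (EFin \o q) ->
  osc_integral (damped n.+1%:R^-1 q) x @[n --> \oo] --> osc_integral q x.
Proof.
move=> iq; apply: fine_cvg; rewrite -/(osc_integral _ _) EFin_osc_integral//.
have [] // := @dominated_convergence _ _ _ mu D _
  (fun n t => (damped n.+1%:R^-1 q t * cos (theta t - t * x))%:E)
  (fun t => (q t * cos (theta t - t * x))%:E) (fun t => `|q t|%:E).
- by move=> n; apply: measurable_int; apply: integrable_osc;
    exact: integrable_damped.
- exact: measurable_int (integrable_osc x iq).
- apply: aeW => t _; apply: cvg_EFin; first exact: nearW.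
  apply: cvgMr_tmp; rewrite -[X in _ --> X]mul1r; apply: cvgMr_tmp.
  rewrite -[X in _ --> X]expR0; apply: continuous_cvg;
    first exact: continuous_expR.
  rewrite -[X in _ --> X]oppr0; apply: cvgN; rewrite -[X in _ --> X](mul0r t).
  by apply: cvgMr_tmp; exact: cvg_harmonic.
- exact: integrable_norm.
- apply: aeW => t n; rewrite /= in_itv/= andbT => t0; rewrite lee_fin normrM.
  by rewrite (le_trans (ler_piMr _ (cos_max _)))// damped_norm_le.
Qed.

End oscillatory_integral.

Section levy_inversion.
Context {R : realType} {d : measure_display} {T : measurableType d}
  (P : probability T R) (Y : {RV P >-> R}) (rho theta : R -> R).
Local Notation mu := (@lebesgue_measure R).
Local Notation D := (`[0%R, +oo[%classic : set R).
Hypothesis cfY : has_polar_cf P Y rho theta.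
Hypothesis mtheta : measurable_fun D theta.
Hypothesis irho : mu.-integrable D (EFin \o rho).
Hypothesis itrho : mu.-integrable D (fun t => (t * rho t)%:E).
Implicit Types a b c e t x : R.

Let rho_norm : R := (\int[mu]_(t in D) `|rho t|)%R.

Let continuous_osc : continuous (osc_integral theta rho).
Proof. exact: continuous_osc_integral. Qed.

Let measurable_osc : measurable_fun [set: R] (osc_integral theta rho).
Proof. exact: continuous_measurable_fun. Qed.

Let expectation_1Dcos x t : 0 <= t ->
  (\int[P]_w (1 + cos (t * (Y w - x)))%:E =
   (1 + rho t * cos (theta t - t * x))%:E)%E.
Proof.
move=> t0; have [+ _] := has_polar_cf_affine x ler01 cfY t0.
under eq_integral do rewrite mul1r; rewrite mulr1 => cosYx.
rewrite -[X in 1 + X]mul1r -(integral_probability_affine 1 1 _ cosYx).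
  by under [RHS]eq_integral do rewrite mul1r.
by apply: integrable_cos; apply: measurable_funM => //; exact: measurable_funB.
Qed.

Let measurable_expRN_1Dcos e x : measurable_fun [set: T * R]
  (fun z => (expR (- (e * z.2)) * (1 + cos (z.2 * (Y z.1 - x))))%:E).
Proof.
apply/measurable_EFinP/measurable_funM.
  apply: (measurableT_comp (f := fun t : R => expR (- (e * t)))) => //.
  exact: measurable_expRN.
apply: measurable_funD => //.
apply: (measurableT_comp (continuous_measurable_fun (@continuous_cos R))).
apply: measurable_funM; first exact: measurable_snd.
by apply: measurable_funB => //; exact: measurableT_comp.
Qed.

Let expectation_Dpoisson_kernel e x : 0 < e ->
  (\int[P]_w (e^-1 + poisson_kernel e (Y w - x))%:E =
   (e^-1 + osc_integral theta (damped e rho) x)%:E)%E.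
Proof.
move=> e0; have ie := integrable_damped (ltW e0) irho.
have ieosc := integrable_osc mtheta x ie.
under eq_integral do rewrite -integral_expRN_1Dcos//.
rewrite (fubini_tonelli_sub P mu (measurable_itv _)
  (measurable_expRN_1Dcos e x)).
  rewrite EFinD EFin_osc_integral// -integral_expRN// -integralD//; last first.
    exact: integrable_expRN.
  apply: eq_integral => t; rewrite inE/= in_itv/= andbT => t0.
  under eq_integral do rewrite EFinM.
  rewrite ge0_integralZl_EFin ?expR_ge0//.
  - by rewrite expectation_1Dcos// -EFinM -EFinD /damped; congr EFin; ring.
  - apply/measurable_EFinP/measurable_funD => //.
    apply: (measurableT_comp (continuous_measurable_fun (@continuous_cos R))).
    by apply: measurable_funM => //; exact: measurable_funB.
by move=> z; rewrite lee_fin mulr_ge0 ?expR_ge0// -lerBlDl sub0r cos_geN1.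
Qed.

Lemma expectation_poisson_kernel e x : 0 < e ->
  (\int[P]_w (poisson_kernel e (Y w - x))%:E =
   (osc_integral theta (damped e rho) x)%:E)%E.
Proof.
move=> e0; have := expectation_Dpoisson_kernel x e0.
under eq_integral do rewrite EFinD.
rewrite ge0_integralD//.
- rewrite integral_probability_cst EFinD.
  rewrite [X in X = _ -> _]addeC [X in _ = X -> _]addeC.
  by move=> /(congr1 (fun z => z - (e^-1)%:E)%E); rewrite !addeK.
- by move=> w _; rewrite lee_fin invr_ge0 ltW.
- by move=> w _; rewrite lee_fin poisson_kernel_ge0// ltW.
- apply/measurable_EFinP.
  apply: (measurableT_comp
    (continuous_measurable_fun (continuous_poisson_kernel e0))).
  exact: measurable_funB.
Qed.

Lemma osc_integral_cf_ge0 x : 0 <= osc_integral theta rho x.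
Proof.
have cvg_osc := cvg_osc_integral_damped mtheta (x := x) irho.
rewrite -(cvg_lim (@Rhausdorff R) cvg_osc); apply: limr_ge.
  by apply/cvg_ex; eexists; exact: cvg_osc.
apply: nearW => n; rewrite -lee_fin -expectation_poisson_kernel//.
by apply: integral_ge0 => w _; rewrite lee_fin poisson_kernel_ge0.
Qed.

Let integral_osc_damped e a b : 0 < e -> a < b ->
  (\int[mu]_(x in `[a, b]) (osc_integral theta (damped e rho) x)%:E =
   \int[P]_w (atan ((b - Y w) / e) - atan ((a - Y w) / e))%:E)%E.
Proof.
move=> e0 ab; pose f (z : T * R) := (poisson_kernel e (Y z.1 - z.2))%:E.
have f0 z : (0 <= f z)%E by rewrite lee_fin poisson_kernel_ge0// ltW.
have mf : measurable_fun [set: T * R] f.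
  apply/measurable_EFinP.
  apply: (measurableT_comp
    (continuous_measurable_fun (continuous_poisson_kernel e0))).
  by apply: measurable_funB; [exact: measurableT_comp|exact: measurable_snd].
under eq_integral do rewrite -expectation_poisson_kernel//.
rewrite -(fubini_tonelli_sub P mu (measurable_itv _) mf f0).
by apply: eq_integral => w _; rewrite -(integral_poisson_kernel (Y w) e0 ab).
Qed.

Let cvg_integral_osc_damped a b :
  (\int[mu]_(x in `[a, b]) (osc_integral theta (damped n.+1%:R^-1 rho) x)%:E)%E
    @[n --> \oo] --> (\int[mu]_(x in `[a, b]) (osc_integral theta rho x)%:E)%E.
Proof.
have [] // := @dominated_convergence _ _ _ mu `[a, b]%classic _
  (fun n x => (osc_integral theta (damped n.+1%:R^-1 rho) x)%:E)
  (fun x => (osc_integral theta rho x)%:E) (cst rho_norm%:E).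
- move=> n; apply/measurable_EFinP; apply: measurable_funTS.
  apply: continuous_measurable_fun.
  apply: continuous_osc_integral => //; first exact: integrable_damped.
  have -> : (fun t => (t * damped n.+1%:R^-1 rho t)%:E) =
      EFin \o damped n.+1%:R^-1 (fun t => t * rho t).
    by apply/funext => t; rewrite /damped /= mulrCA.
  exact: integrable_damped.
- by apply/measurable_EFinP; exact: measurable_funTS.
- apply: aeW => x _; apply: cvg_EFin; first exact: nearW.
  exact: cvg_osc_integral_damped.
- apply: (@continuous_compact_integrable _ (cst _));
    first exact: segment_compact.
  by apply: continuous_subspaceT => ?; exact: cvg_cst.
- by apply: aeW => x n _; rewrite lee_fin; exact: osc_integral_damped_bounded.
Qed.

Let measurable_sgrB c : measurable_fun [set: T] (fun w => Num.sg (c - Y w)).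
Proof. by apply: (measurableT_comp measurable_sgr); exact: measurable_funB. Qed.

Let cvg_expectation_atan a b :
  (\int[P]_w
    (atan ((b - Y w) / n.+1%:R^-1) - atan ((a - Y w) / n.+1%:R^-1))%:E)%E
    @[n --> \oo] -->
  (\int[P]_w (pi / 2 * (Num.sg (b - Y w) - Num.sg (a - Y w)))%:E)%E.
Proof.
have matan c n :
    measurable_fun [set: T] (fun w => atan ((c - Y w) / n.+1%:R^-1)).
  apply: (measurableT_comp (continuous_measurable_fun (@continuous_atan R))).
  by apply: measurable_funM => //; exact: measurable_funB.
have [] // := @dominated_convergence _ _ _ P setT _
  (fun n w =>
    (atan ((b - Y w) / n.+1%:R^-1) - atan ((a - Y w) / n.+1%:R^-1))%:E)
  (fun w => (pi / 2 * (Num.sg (b - Y w) - Num.sg (a - Y w)))%:E) (cst pi%:E).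
- by move=> n; apply/measurable_EFinP/measurable_funB; exact: matan.
- by apply/measurable_EFinP/measurable_funM => //; exact: measurable_funB.
- apply: aeW => w _; apply: cvg_EFin; first exact: nearW.
  by rewrite mulrBr; apply: cvgB; exact: cvg_atan_sgr.
- exact: finite_measure_integrable_cst.
- apply: aeW => w n _; rewrite lee_fin ler_norml.
  have := atan_gtNpi2 ((b - Y w) / n.+1%:R^-1).
  have := atan_ltpi2 ((b - Y w) / n.+1%:R^-1).
  have := atan_gtNpi2 ((a - Y w) / n.+1%:R^-1).
  have := atan_ltpi2 ((a - Y w) / n.+1%:R^-1).
  lra.
Qed.

Lemma levy_inversion a b : a < b ->
  (\int[mu]_(x in `[a, b]) (osc_integral theta rho x)%:E =
   \int[P]_w (pi / 2 * (Num.sg (b - Y w) - Num.sg (a - Y w)))%:E)%E.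
Proof.
move=> ab.
rewrite -(cvg_lim (@ereal_hausdorff R) (@cvg_integral_osc_damped a b)).
apply: cvg_lim => //; move: (@cvg_expectation_atan a b).
apply: cvg_trans; apply: near_eq_cvg.
by apply: nearW => n; rewrite integral_osc_damped.
Qed.

Let prob_set1_le a b x : a < x < b ->
  (P (Y @^-1` [set x]) <= ((b - a) * rho_norm)%:E)%E.
Proof.
move=> /andP[ax xb]; have ab := lt_trans ax xb.
rewrite -[X in P X]setIT -integral_indic//.
apply: (@le_trans _ _
  (\int[P]_w (pi / 2 * (Num.sg (b - Y w) - Num.sg (a - Y w)))%:E)%E).
  apply: ge0_le_integral => //.
  - exact/measurable_EFinP.
  - by apply/measurable_EFinP/measurable_funM => //; exact: measurable_funB.
  - move=> w _; rewrite lee_fin indicE.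
    have [/set_mem /= ->|_] := boolP (w \in _).
      rewrite gtr0_sg ?subr_gt0// ltr0_sg ?subr_lt0//.
      by have := pi_ge2 R; lra.
    rewrite mulr_ge0 ?divr_ge0 ?pi_ge0// subr_ge0 sgr_le//.
    by rewrite lerD2r ltW.
rewrite -levy_inversion//.
apply: (@le_trans _ _ (\int[mu]_(z in `[a, b]) rho_norm%:E)%E); last first.
  by rewrite integral_cst//= lebesgue_measure_itv/= lte_fin ab -EFinM mulrC.
apply: ge0_le_integral => //.
- by move=> z _; rewrite lee_fin osc_integral_cf_ge0.
- by apply/measurable_EFinP; exact: measurable_funTS.
- move=> z _; rewrite lee_fin (le_trans (ler_norm _))//.
  exact: osc_integral_bounded.
Qed.

Lemma polar_cf_no_atom x : P (Y @^-1` [set x]) = 0%E.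
Proof.
apply/eqP; rewrite eq_le measure_ge0 andbT; apply/lee_addgt0Pr => e e0.
have norm_ge0 : 0 <= rho_norm by exact: Rintegral_ge0.
pose c := e / (2 * (rho_norm + 1)).
have c0 : 0 < c by rewrite divr_gt0// mulr_gt0// ltr_wpDl.
have ce : 2 * c * (rho_norm + 1) = e.
  by rewrite mulrAC /c mulrC divfK// gt_eqF// mulr_gt0// ltr_wpDl.
rewrite add0e (le_trans (@prob_set1_le (x - c) (x + c) _ _))//; first by lra.
rewrite lee_fin -[leRHS]ce; nra.
Qed.

Lemma polar_cf_prob_itv a b : a < b ->
  (P (Y @^-1` `]a, b]) =
   \int[mu]_(x in `]a, b]) (pi^-1 * osc_integral theta rho x)%:E)%E.
Proof.
move=> ab; have mE : measurable (Y @^-1` `]a, b]) by exact: measurable_funPTI.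
have pi0 : (pi : R) != 0 by rewrite gt_eqF// pi_gt0.
have sgr_indic : ae_eq P [set: T]
    (fun w => (pi / 2 * (Num.sg (b - Y w) - Num.sg (a - Y w)))%:E)
    (fun w => pi%:E * (\1_(Y @^-1` `]a, b]) w)%:E)%E.
  have null c : P.-negligible (Y @^-1` [set c]).
    by apply/negligibleP; [exact: measurable_funPTI|exact: polar_cf_no_atom].
  apply: negligibleS (negligibleU (null a) (null b)) => w /= neq_w.
  have [->|ya] := eqVneq (Y w) a; first by left.
  have [->|yb] := eqVneq (Y w) b; first by right.
  by exfalso; apply: neq_w => _; rewrite -EFinM sgrB_itv// mulrA divfK.
under [RHS]eq_integral do rewrite EFinM.
rewrite ge0_integralZl_EFin//; last 3 first.
- by move=> x _; rewrite lee_fin osc_integral_cf_ge0.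
- by apply/measurable_EFinP; exact: measurable_funTS.
- by rewrite invr_ge0 pi_ge0.
rewrite integral_itv_obnd_cbnd; last first.
  by apply/measurable_EFinP; exact: measurable_funTS.
have mind : measurable_fun [set: T]
    (fun w => (\1_(Y @^-1` `]a, b]) w)%:E : \bar R).
  exact/measurable_EFinP.
rewrite levy_inversion// (ae_eq_integral _ _ _ _ _ sgr_indic)//.
- rewrite ge0_integralZl_EFin ?pi_ge0// integral_indic// setIT.
  by rewrite muleA -EFinM mulVf// mul1e.
- by apply/measurable_EFinP/measurable_funM => //; exact: measurable_funB.
- exact: measurable_funeM.
Qed.

Theorem polar_cf_is_density :
  is_density P Y (fun x => pi^-1 * osc_integral theta rho x).
Proof.
apply: is_density_of_itv => [|x|]; last exact: polar_cf_prob_itv.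
  exact: measurable_funM.
by rewrite mulr_ge0 ?invr_ge0 ?pi_ge0// osc_integral_cf_ge0.
Qed.

End levy_inversion.

(** * Differential entropy of cell averages *)

Section cells.
Context {R : realType}.
Local Notation mu := (@lebesgue_measure R).
Implicit Types (c D x y : R) (k : int).

Definition cell_index c D x : int := Num.floor ((x - c) / D).

Definition cell c D k : set R := cell_index c D @^-1` [set k].

Lemma cell_itv c D k : 0 < D ->
  cell c D k = `[c + k%:~R * D, c + (k + 1)%:~R * D[%classic.
Proof.
move=> D0; rewrite /cell /cell_index; apply/seteqP;
  split=> x /=; rewrite in_itv/=.
  move=> <-; have := floor_itv ((x - c) / D).
  by rewrite ler_pdivlMr// ltr_pdivrMr// lerBrDl ltrBlDl.
by rewrite -lerBrDl -ltrBlDl -ler_pdivlMr// -ltr_pdivrMr//; exact: floor_def.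
Qed.

Lemma measurable_cell c D k : 0 < D ->
  (R.-ocitv.-measurable).-sigma.-measurable (cell c D k).
Proof. by move=> D0; rewrite cell_itv//; exact: measurable_itv. Qed.

Lemma lebesgue_measure_cell c D k : 0 < D -> mu (cell c D k) = D%:E.
Proof.
move=> D0; rewrite cell_itv// lebesgue_measure_itv/= lte_fin ltrD2l ltr_pM2r//.
by rewrite ltr_int ltrDl ltr01 -EFinB intrD; congr EFin; ring.
Qed.

Lemma integrable_cell_cst c D k (r : R) : 0 < D ->
  mu.-integrable (cell c D k) (EFin \o (fun=> r)).
Proof.
move=> D0; apply: measurable_bounded_integrable => //;
  first exact: measurable_cell.
  by rewrite [X in (X < _)%E]lebesgue_measure_cell// ltry.
by exists `|r|; split; [exact: num_real|move=> M rM x _; exact: ltW].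
Qed.

Lemma Rintegral_cell_cst c D k (r : R) : 0 < D ->
  (\int[mu]_(x in cell c D k) r)%R = r * D.
Proof.
move=> D0; rewrite Rintegral_cst/=; last exact: measurable_cell.
by rewrite lebesgue_measure_cell.
Qed.

Lemma cell_dist c D k x y : 0 < D -> cell c D k x -> cell c D k y ->
  `|x - y| <= D.
Proof.
move=> D0; rewrite cell_itv//= !in_itv/= intrD mulrDl mul1r.
move=> /andP[? ?] /andP[? ?].
by rewrite ler_norml; lra.
Qed.

Lemma ge0_integral_cells c D (f : R -> R) : 0 < D ->
  measurable_fun [set: R] f -> (forall x, 0 <= f x) ->
  (\int[mu]_x (f x)%:E =
   \esum_(k in [set: int]) \int[mu]_(x in cell c D k) (f x)%:E)%E.
Proof.
move=> D0 mf f0; apply: ge0_integral_countable_bigcup.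
- by move=> k; exact: measurable_cell.
- exact: trivIset_preimage1.
- by apply/seteqP; split=> // x _; exists (cell_index c D x).
- exact/measurable_EFinP.
- by move=> x; rewrite lee_fin.
Qed.

Lemma measurable_cell_comp c D (v : int -> R) : 0 < D ->
  measurable_fun [set: R] (v \o cell_index c D).
Proof.
move=> D0 _ B mB; rewrite setTI.
have -> : (v \o cell_index c D) @^-1` B = \bigcup_(k in v @^-1` B) cell c D k.
  apply/seteqP; split=> [x Bx|x [k Bk /= kx]]; last by rewrite /= kx.
  by exists (cell_index c D x).
rewrite bigcup_mkcond; apply: countable_bigcupT_measurable => // k.
by case: ifPn => _ //; exact: measurable_cell.
Qed.

End cells.

Section cell_average.
Context {R : realType} (g : R -> R) (c D : R).
Local Notation mu := (@lebesgue_measure R).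
Hypothesis D0 : 0 < D.
Hypothesis g0 : forall x, 0 <= g x.
Hypothesis ig : mu.-integrable [set: R] (EFin \o g).
Implicit Types (k : int) (x : R).

Definition cell_mass k : R := (\int[mu]_(x in cell c D k) g x)%R.

Definition cell_average x : R := cell_mass (cell_index c D x) / D.

Let mcell k := measurable_cell c k D0.

Let integrable_cell (f : R -> R) k : mu.-integrable [set: R] (EFin \o f) ->
  mu.-integrable (cell c D k) (EFin \o f).
Proof. by apply: integrableS => //; exact: mcell. Qed.

Lemma cell_mass_ge0 k : 0 <= cell_mass k.
Proof. exact: Rintegral_ge0. Qed.

Lemma EFin_cell_mass k :
  ((cell_mass k)%:E = \int[mu]_(x in cell c D k) (g x)%:E)%E.
Proof.
by rewrite EFin_Rintegral//; exact: integrable_cell.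
Qed.

Lemma cell_average_ge0 x : 0 <= cell_average x.
Proof. by rewrite divr_ge0 ?cell_mass_ge0// ltW. Qed.

Lemma measurable_cell_average : measurable_fun [set: R] cell_average.
Proof. exact: (measurable_cell_comp c (fun k => cell_mass k / D)). Qed.

Lemma cell_average_le M x : (forall y, g y <= M) -> cell_average x <= M.
Proof.
move=> gM; rewrite ler_pdivrMr//
  -(Rintegral_cell_cst c (cell_index c D x) M D0).
by apply: le_Rintegral => //;
  [exact: integrable_cell|exact: integrable_cell_cst].
Qed.

Lemma cell_average_dist L x : L.-lipschitz g ->
  `|cell_average x - g x| <= L * D.
Proof.
move=> gLip; have L0 := klipschitz_ge0 gLip; set k := cell_index c D x.
have g_near y : cell c D k y -> `|g y - g x| <= L * D.
  move=> Cy; have /klipschitzP gL := gLip.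
  by rewrite (le_trans (gL _ _))// ler_wpM2l// (cell_dist D0 Cy).
have [icell icst] :=
  (integrable_cell k ig, fun r => integrable_cell_cst c k r D0).
rewrite ler_distl /cell_average -/k ler_pdivlMr// ler_pdivrMr//.
rewrite -(Rintegral_cell_cst c k (g x - L * D) D0).
rewrite -(Rintegral_cell_cst c k (g x + L * D) D0).
apply/andP; split; apply: le_Rintegral => // y /g_near; rewrite ler_distl.
  by move=> /andP[].
by move=> /andP[].
Qed.

Lemma integral_cell_average_comp (F : R -> R) : measurable_fun [set: R] F ->
  (forall x, 0 <= F (cell_average x)) ->
  (\int[mu]_x (F (cell_average x))%:E =
   \esum_(k in [set: int]) (F (cell_mass k / D) * D)%:E)%E.
Proof.
move=> mF F0; rewrite (ge0_integral_cells c D0)//; last first.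
  exact: measurableT_comp mF measurable_cell_average.
apply: eq_esum => k _.
under eq_integral => x do rewrite inE /cell_average => ->.
by rewrite integral_cst//= lebesgue_measure_cell.
Qed.

Lemma integral_cell_average :
  (\int[mu]_x (cell_average x)%:E = \int[mu]_x (g x)%:E)%E.
Proof.
rewrite (integral_cell_average_comp (F := id))//; last exact: cell_average_ge0.
rewrite (ge0_integral_cells c D0)//; last first.
  by apply/measurable_EFinP; exact: measurable_int ig.
by apply: eq_esum => k _; rewrite divfK ?gt_eqF// EFin_cell_mass.
Qed.

Let integrable_averageM (h : R -> R) K :
  mu.-integrable [set: R] (EFin \o (fun x => g x * h x)) ->
  mu.-integrable [set: R] (EFin \o (fun x => g x * h x + K * D * g x)).
Proof.
by move=> igh; exact: (integrableD _ igh (integrableZl _ (K * D) ig)).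
Qed.

(* On a cell [h x <= h y + K D]; average over [y] with weight [g y]. *)
Let cell_averageM_le (h : R -> R) K k x : K.-lipschitz h ->
  mu.-integrable [set: R] (EFin \o (fun x => g x * h x)) -> cell c D k x ->
  cell_average x * h x <=
    (\int[mu]_(y in cell c D k) (g y * h y + K * D * g y))%R / D.
Proof.
move=> hLip igh xk; have /klipschitzP hK := hLip.
have /= -> : cell_average x = cell_mass k / D by rewrite -xk.
rewrite mulrAC ler_pM2r ?invr_gt0// -RintegralZr//; last exact: integrable_cell.
apply: le_Rintegral => // [| |y yk].
- exact: (integrableZr (mcell k) (h x) (integrable_cell k ig)).
- by apply: integrable_cell; exact: integrable_averageM.
- have hxy : h x - h y <= K * D.
    rewrite (le_trans (ler_norm _))// (le_trans (hK _ _))//.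
    by rewrite ler_wpM2l ?(klipschitz_ge0 hLip)// (cell_dist D0 xk yk).
  by have := ler_wpM2l (g0 y) hxy; lra.
Qed.

Lemma integral_cell_average_lipschitz (h : R -> R) K : K.-lipschitz h ->
  (forall x, 0 <= h x) ->
  mu.-integrable [set: R] (EFin \o (fun x => g x * h x)) ->
  (\int[mu]_x (cell_average x * h x)%:E <=
   \int[mu]_x (g x * h x + K * D * g x)%:E)%E.
Proof.
move=> hLip h0 igh; have K0 := klipschitz_ge0 hLip.
have mavgh : measurable_fun [set: R] (fun x => cell_average x * h x).
  apply: measurable_funM; first exact: measurable_cell_average.
  exact: continuous_measurable_fun (klipschitz_continuous hLip).
have avgh0 x : 0 <= cell_average x * h x by rewrite mulr_ge0// cell_average_ge0.
have iu := integrable_averageM K igh.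
rewrite (ge0_integral_cells c D0 mavgh avgh0).
rewrite [leRHS](ge0_integral_cells c D0); last 2 first.
- by apply/measurable_EFinP; exact: measurable_int iu.
- by move=> x; rewrite addr_ge0 ?mulr_ge0// ltW.
apply: le_esum => k _.
pose J := (\int[mu]_(y in cell c D k) (g y * h y + K * D * g y))%R.
apply: (@le_trans _ _ (\int[mu]_(x in cell c D k) (J / D)%:E)%E).
  apply: ge0_le_integral => //.
  - by move=> x _; rewrite lee_fin.
  - by apply/measurable_EFinP; exact: measurable_funTS.
  - by move=> x xk; rewrite lee_fin cell_averageM_le.
rewrite integral_cst//= lebesgue_measure_cell// -EFinM divfK ?gt_eqF//.
rewrite EFin_Rintegral//.
exact: integrable_cell.
Qed.

End cell_average.

Section log_density.
Context {R : realType}.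
Local Notation mu := (@lebesgue_measure R).
Implicit Types (g : R -> R) (c D M x : R).

(* Probability densities for which [g ln g] is integrable: [- g ln g] is bounded
   below thanks to the bound on [g] and above, through Gibbs' inequality against
   [1 / (1 + x^2)], thanks to the logarithmic moment. *)
Definition log_density g : Prop :=
  [/\ measurable_fun [set: R] g, forall x, 0 <= g x,
      exists M, forall x, g x <= M,
      (\int[mu]_x (g x)%:E = 1)%E &
      mu.-integrable [set: R] (EFin \o (fun x => g x * ln (oneDsqr x)))].

Lemma log_density_integrable g : log_density g ->
  mu.-integrable [set: R] (EFin \o g).
Proof.
move=> [mg g0 _ g1 _]; apply/integrableP; split; first exact/measurable_EFinP.
by under eq_integral do rewrite /= ger0_norm//; rewrite g1 ltry.
Qed.

Lemma log_density_Rintegral g : log_density g -> (\int[mu]_x g x)%R = 1.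
Proof. by move=> [_ _ _ g1 _]; rewrite /Rintegral g1. Qed.

Lemma log_density_integrable_xlnx g : log_density g ->
  mu.-integrable [set: R] (EFin \o (fun x => g x * ln (g x))).
Proof.
move=> dg; have ig := log_density_integrable dg; have [mg g0 [M gM] _ il] := dg.
have ib := integrableD _ (integrableD _ (integrableZl _ M ig) il)
  integrable_oneDsqrV.
apply: (le_integrable _ _ _ (ib measurableT measurableT measurableT)) => //.
  apply/measurable_EFinP/measurable_funM => //.
  exact: measurableT_comp (@measurable_ln R) mg.
move=> x _; rewrite lee_fin /=.
have M0 : 0 <= M * g x by rewrite mulr_ge0// (le_trans (g0 x)).
have l0 : 0 <= g x * ln (oneDsqr x) by rewrite mulr_ge0// ln_oneDsqr_ge0.
have w0 : 0 < (oneDsqr x)^-1 by rewrite invr_gt0 oneDsqr_gt0.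
rewrite [leRHS]ger0_norm ?addr_ge0 ?(ltW w0)// ler_norml; apply/andP; split.
  have := gibbs (g0 x) w0; rewrite lnV ?posrE ?oneDsqr_gt0//.
  by have := g0 x; lra.
suff : g x * ln (g x) <= M * g x by lra.
have [->|gx0] := eqVneq (g x) 0; first by rewrite mul0r mulr0.
have gx_gt0 : 0 < g x by rewrite lt0r gx0 g0.
by rewrite mulrC ler_wpM2r// (le_trans (ltW (ln_sublinear gx_gt0))).
Qed.

Lemma log_density_cell_average g c D : 0 < D -> log_density g ->
  log_density (cell_average g c D).
Proof.
move=> D0 dg; have ig := log_density_integrable dg.
have [mg g0 [M gM] g1 il] := dg.
split.
- exact: measurable_cell_average.
- by move=> x; exact: cell_average_ge0.
- by exists M => x; exact: cell_average_le.
- by rewrite integral_cell_average.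
- have avg0 x : 0 <= cell_average g c D x * ln (oneDsqr x).
    by rewrite mulr_ge0 ?cell_average_ge0 ?ln_oneDsqr_ge0.
  apply/integrableP; split.
    apply/measurable_EFinP/measurable_funM;
      first exact: measurable_cell_average.
    exact: measurable_ln_oneDsqr.
  under eq_integral do rewrite /= ger0_norm//.
  apply: le_lt_trans (integral_cell_average_lipschitz c D0 g0 ig
    ln_oneDsqr_lipschitz ln_oneDsqr_ge0 il) _.
  apply: integrable_lty => //.
  exact: (integrableD _ il (integrableZl _ (1 * D) ig)).
Qed.

Let entropy_scaleE g D x : 0 < D -> 0 <= g x ->
  - (g x * ln (g x * D)) = -1 * (g x * ln (g x)) - g x * ln D.
Proof.
move=> D0; rewrite le_eqVlt => /predU1P[<-|gx_gt0].
  by rewrite !(mul0r, mulr0) oppr0 addr0.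
by rewrite lnM ?posrE// mulrDr mulN1r opprD.
Qed.

Lemma integrable_entropy_scale g D : 0 < D -> log_density g ->
  mu.-integrable [set: R] (EFin \o (fun x => - (g x * ln (g x * D)))).
Proof.
move=> D0 dg; have [_ g0 _ _ _] := dg.
have [ig igl] := (log_density_integrable dg, log_density_integrable_xlnx dg).
have ientropy := integrableZl measurableT (-1) igl.
apply: (eq_integrable _ _ _ _
  (integrableB _ ientropy (integrableZr _ (ln D) ig))) => //.
by move=> x _ /=; rewrite -EFinM -EFinB entropy_scaleE.
Qed.

Lemma integral_entropy_scale g D : 0 < D -> log_density g ->
  (\int[mu]_x (- (g x * ln (g x * D)))%:E = (diff_entropy g - ln D)%:E)%E.
Proof.
move=> D0 dg; have [_ g0 _ _ _] := dg.
have [ig igl] := (log_density_integrable dg, log_density_integrable_xlnx dg).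
rewrite -EFin_Rintegral//; last exact: integrable_entropy_scale.
under eq_Rintegral do rewrite entropy_scaleE//.
rewrite RintegralB//;
  [|exact: (integrableZl _ (-1) igl)|exact: (integrableZr _ (ln D) ig)].
rewrite (RintegralZl _ measurableT igl) (RintegralZr _ measurableT ig).
by rewrite (log_density_Rintegral dg) mul1r mulN1r.
Qed.

Lemma cell_mass_le1 g c D k : 0 < D -> log_density g -> cell_mass g c D k <= 1.
Proof.
move=> D0 dg; have ig := log_density_integrable dg; have [mg g0 _ g1 _] := dg.
rewrite -lee_fin EFin_cell_mass// -g1 ge0_subset_integral//.
- exact: measurable_cell.
- exact/measurable_EFinP.
- by move=> x _; rewrite lee_fin.
Qed.

Lemma esum_cell_mass_entropy g c D : 0 < D -> log_density g ->
  (\esum_(k in [set: int]) (- (cell_mass g c D k * ln (cell_mass g c D k)))%:E =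
   (diff_entropy (cell_average g c D) - ln D)%:E)%E.
Proof.
move=> D0 dg; have [_ g0 _ _ _] := dg.
rewrite -integral_entropy_scale//; last exact: log_density_cell_average.
rewrite (integral_cell_average_comp D0 (F := fun t => - (t * ln (t * D))))//.
- by apply: eq_esum => k _; rewrite divfK ?gt_eqF// mulNr mulrAC divfK ?gt_eqF.
- apply: measurable_funN; apply: measurable_funM => //.
  apply: (measurableT_comp (@measurable_ln R)); exact: measurable_funM.
- move=> x; rewrite oppr_ge0 mulr_ge0_le0 ?cell_average_ge0// ln_le0//.
  by rewrite /cell_average divfK ?gt_eqF// cell_mass_le1.
Qed.

Let cell_entropy_le g c D k : 0 < D -> log_density g ->
  (\int[mu]_(x in cell c D k) (- (g x * ln (g x * D))) <=
   - (cell_mass g c D k * ln (cell_mass g c D k)))%R.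
Proof.
move=> D0 dg; have ig := log_density_integrable dg; have [_ g0 _ _ _] := dg.
have mk := measurable_cell c k D0; set p := cell_mass g c D k.
have integrable_cell h : mu.-integrable [set: R] (EFin \o h) ->
    mu.-integrable (cell c D k) (EFin \o h) by exact: integrableS.
have p0 : 0 <= p by exact: cell_mass_ge0.
have entropy_le u : 0 < u ->
    (\int[mu]_(x in cell c D k) (- (g x * ln (g x * D))))%R <=
    u - p * (ln u + 1).
  move=> u0; have -> : u - p * (ln u + 1) = p * (- (ln u + 1)) + (u / D) * D.
    by rewrite divfK ?gt_eqF//; ring.
  have igk r : mu.-integrable (cell c D k) (EFin \o (fun x => g x * r)).
    exact: (integrableZr mk r (integrable_cell g ig)).
  rewrite -(Rintegral_cell_cst c k _ D0)
    -(RintegralZr _ mk (integrable_cell g ig)).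
  rewrite -RintegralD//; last exact: integrable_cell_cst.
  apply: le_Rintegral => //.
  - exact/integrable_cell/integrable_entropy_scale.
  - exact: (integrableD _ (igk _) (integrable_cell_cst c k (u / D) D0)).
  - move=> x _; rewrite -(ler_pM2r D0).
    have -> : (g x * - (ln u + 1) + u / D) * D = u - g x * D * (ln u + 1).
      by field; rewrite gt_eqF.
    by have := gibbs (mulr_ge0 (g0 x) (ltW D0)) u0; lra.
have [p_eq0|p_neq0] := eqVneq p 0.
  rewrite p_eq0 mul0r oppr0; apply/ler_addgt0Pr => e e0.
  by have := entropy_le e e0; rewrite p_eq0 mul0r subr0 add0r.
have p_gt0 : 0 < p by rewrite lt0r p_neq0.
by have := entropy_le p p_gt0; lra.
Qed.

Lemma diff_entropy_le_cell_average g c D M : 0 < D -> log_density g ->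
  (forall x, g x <= M) -> M * D <= 1 ->
  diff_entropy g <= diff_entropy (cell_average g c D).
Proof.
move=> D0 dg gM MD; have [mg g0 _ _ _] := dg.
rewrite -(lerD2r (- ln D)) -lee_fin -esum_cell_mass_entropy//.
rewrite -integral_entropy_scale//.
have ie := integrable_entropy_scale D0 dg.
rewrite (ge0_integral_cells c D0)//.
- apply: le_esum => k _; have mk := measurable_cell c k D0.
  by rewrite -EFin_Rintegral ?lee_fin ?cell_entropy_le//; exact: integrableS ie.
- by apply/measurable_EFinP; exact: measurable_int ie.
- move=> x; rewrite oppr_ge0 mulr_ge0_le0// ln_le0//.
  by apply: le_trans MD; rewrite ler_wpM2r// ltW.
Qed.

End log_density.

Section entropy_semicontinuity.
Context {R : realType}.
Local Notation mu := (@lebesgue_measure R).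
Implicit Types (f g : R -> R) (c D L x e : R).

Definition cauchy_divergence g x : R :=
  g x * ln (g x) + g x * ln (oneDsqr x) - g x + (oneDsqr x)^-1.

Definition ln_oneDsqr_moment g : R := (\int[mu]_x (g x * ln (oneDsqr x)))%R.

Lemma cauchy_divergence_ge0 g x : 0 <= g x -> 0 <= cauchy_divergence g x.
Proof.
move=> gx0; have w0 : 0 < (oneDsqr x)^-1 by rewrite invr_gt0 oneDsqr_gt0.
have := gibbs gx0 w0; rewrite lnV ?posrE ?oneDsqr_gt0// /cauchy_divergence.
by lra.
Qed.

Lemma measurable_cauchy_divergence g : measurable_fun [set: R] g ->
  measurable_fun [set: R] (cauchy_divergence g).
Proof.
move=> mg; apply: measurable_funD.
  apply: measurable_funB => //; apply: measurable_funD;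
    apply: measurable_funM => //.
    exact: measurableT_comp (@measurable_ln R) mg.
  exact: measurable_ln_oneDsqr.
exact: continuous_measurable_fun continuous_oneDsqrV.
Qed.

Lemma integral_cauchy_divergence g : log_density g ->
  (\int[mu]_x (cauchy_divergence g x)%:E =
   (ln_oneDsqr_moment g - diff_entropy g - 1 +
    (\int[mu]_x (oneDsqr x)^-1)%R)%:E)%E.
Proof.
move=> dg; have [_ _ _ _ il] := dg.
have [ig igl] := (log_density_integrable dg, log_density_integrable_xlnx dg).
have iw := @integrable_oneDsqrV R.
have ixl := integrableD measurableT igl il.
have ixlg := integrableB measurableT ixl ig.
rewrite -EFin_Rintegral//; last exact: (integrableD _ ixlg iw).
rewrite RintegralD// RintegralB// RintegralD// (log_density_Rintegral dg).
by rewrite /ln_oneDsqr_moment /diff_entropy opprK [X in X - 1]addrC.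
Qed.

(* Fatou's lemma for the relative entropy densities with respect to the Cauchy
   weight, which are nonnegative by Gibbs' inequality. *)
Lemma diff_entropy_upper_semicontinuous (f : nat -> R -> R) g (u : nat -> R) e :
  (forall n, log_density (f n)) -> log_density g ->
  (forall x, f n x @[n --> \oo] --> g x) ->
  (forall n, ln_oneDsqr_moment (f n) <= ln_oneDsqr_moment g + u n) ->
  u n @[n --> \oo] --> 0 -> 0 < e ->
  \forall n \near \oo, diff_entropy (f n) <= diff_entropy g + e.
Proof.
move=> df dg fg fu u0 e0.
pose I g' := (\int[mu]_x (cauchy_divergence g' x)%:E)%E.
have fatou_f : (I g <= limn_einf (fun n => I (f n)))%E.
  have fE x : (cauchy_divergence g x)%:E =
      limn_einf (fun n => (cauchy_divergence (f n) x)%:E).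
    have cvg_x : (cauchy_divergence (f n) x)%:E @[n --> \oo] -->
        (cauchy_divergence g x)%:E.
      have [_ g0 _ _ _] := dg; apply: cvg_EFin; first exact: nearW.
      apply: cvgD; last exact: cvg_cst.
      apply: cvgB => //; apply: cvgD; last exact: cvgMr_tmp.
      by apply: cvg_xlnx => // n; have [] := df n.
    by have [-> _] := cvg_limn_einf_sup cvg_x.
  rewrite /I; under eq_integral do rewrite fE; apply: fatou => // n.
    apply/measurable_EFinP; apply: measurable_cauchy_divergence.
    by have [] := df n.
  by move=> x _; rewrite lee_fin cauchy_divergence_ge0//; have [] := df n.
have e2_gt0 : 0 < e / 2 by rewrite divr_gt0.
have near_I : \forall n \near \oo, (I g - (e / 2)%:E < I (f n))%E.
  apply: near_limn_einf; apply: lt_le_trans fatou_f.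
  by rewrite /I integral_cauchy_divergence// -EFinB lte_fin ltrBlDr ltrDl.
have near_u : \forall n \near \oo, u n <= e / 2.
  by have /cvgr_le := u0; apply.
apply: filterS2 near_I near_u => n; rewrite /I !integral_cauchy_divergence//.
by rewrite -EFinB lte_fin; have := fu n; lra.
Qed.

Lemma ln_oneDsqr_moment_cell_average g c D : 0 < D -> log_density g ->
  ln_oneDsqr_moment (cell_average g c D) <= ln_oneDsqr_moment g + D.
Proof.
move=> D0 dg; have [mg g0 _ _ il] := dg; have ig := log_density_integrable dg.
have [_ _ _ _ ila] := log_density_cell_average c D0 dg.
have iD := integrableZl measurableT (1 * D) ig.
rewrite -lee_fin EFin_Rintegral//.
apply: le_trans (integral_cell_average_lipschitz c D0 g0 ig
  ln_oneDsqr_lipschitz (@ln_oneDsqr_ge0 R) il) _.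
rewrite -EFin_Rintegral//; last exact: (integrableD _ il iD).
rewrite RintegralD// (RintegralZl _ measurableT ig) (log_density_Rintegral dg).
by rewrite mul1r mulr1.
Qed.

Lemma diff_entropy_cell_average_le g L e : log_density g -> L.-lipschitz g ->
  0 < e -> exists2 delta, 0 < delta & forall c D, 0 < D <= delta ->
    diff_entropy (cell_average g c D) <= diff_entropy g + e.
Proof.
move=> dg gLip e0; apply: contrapT => no_delta.
have /choice[cD cDP] (n : nat) : exists cD : R * R, 0 < cD.2 <= n.+1%:R^-1 /\
    diff_entropy g + e < diff_entropy (cell_average g cD.1 cD.2).
  apply: contrapT => /forallNP no_cD; apply: no_delta.
  exists n.+1%:R^-1 => // c D Dn; rewrite leNgt; apply/negP => lt_e.
  by apply: (no_cD (c, D)).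
have D0 n : 0 < (cD n).2 by have [/andP[]] := cDP n.
have cvgD0 : (cD n).2 @[n --> \oo] --> (0 : R).
  apply: (@squeeze_cvgr _ _ _ _ (cst 0) (fun n => n.+1%:R^-1)).
  - by apply: nearW => n; have [/andP[/ltW -> ->]] := cDP n.
  - exact: cvg_cst.
  - exact: cvg_harmonic.
have [] := @diff_entropy_upper_semicontinuous
  (fun n => cell_average g (cD n).1 (cD n).2) g
    (fun n => (cD n).2) e _ dg _ _ cvgD0 e0.
- by move=> n; exact: log_density_cell_average.
- move=> x; apply/subr_cvg0; apply: norm_cvg0.
  apply: (@squeeze_cvgr _ _ _ _ (cst 0) (fun n => L * (cD n).2)).
  + apply: nearW => n; rewrite normr_ge0 cell_average_dist//.
    exact: log_density_integrable.
  + exact: cvg_cst.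
  + by rewrite -[0 in X in _ --> X](mulr0 L); exact: cvgMl_tmp.
- by move=> n; exact: ln_oneDsqr_moment_cell_average.
move=> n _ /(_ n (leqnn n)); rewrite leNgt => /negP; apply.
by have [] := cDP n.
Qed.

End entropy_semicontinuity.

Section quantized_entropy.
Context {R : realType} {d : measure_display} {T : measurableType d}
  (P : probability T R).
Implicit Types (g : R -> R) (Y : {RV P >-> R}) (Q : T -> R) (f : int -> R).

(* Only the values of [f] have positive probability, so the sum over all reals
   in the entropy reduces to a sum over the cells. *)
Lemma discrete_entropy_cell_mass Q Y g c D f : 0 < D -> is_density P Y g ->
  injective f -> (forall w, Q w = f (cell_index c D (Y w))) ->
  (discrete_entropy P Q =
   \esum_(k in [set: int])
     (- (cell_mass g c D k * ln (cell_mass g c D k)))%:E)%E.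
Proof.
move=> D0 dY f_inj QE; have [mg [_ gP]] := dY.
have preimageE k : Q @^-1` [set f k] = Y @^-1` cell c D k.
  by apply/seteqP; split=> w /=; rewrite QE; [move/f_inj|move=> ->].
rewrite /discrete_entropy.
transitivity (\esum_(y in range f)
    (let p := fine (P (Q @^-1` [set y])) in (- (p * ln p))%:E))%E.
  rewrite [RHS]esum_mkcond; apply: eq_esum => y _.
  case: ifPn => //; rewrite notin_setE => fy.
  rewrite (_ : Q @^-1` [set y] = set0) ?measure0 ?mul0r ?oppr0//.
  apply/seteqP; split=> // w /= Qw; apply: fy.
  by exists (cell_index c D (Y w)); rewrite // -QE.
rewrite esum_image; last by move=> j k _ _; exact: f_inj.
by apply: eq_esum => k _ /=; rewrite preimageE gP//; exact: measurable_cell.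
Qed.

Lemma discrete_entropy_cell_index Q Y g (c D : R) f : 0 < D ->
  is_density P Y g -> log_density g -> injective f ->
  (forall w, Q w = f (cell_index c D (Y w))) ->
  discrete_entropy P Q = (diff_entropy (cell_average g c D) - ln D)%:E.
Proof.
move=> D0 dY dg f_inj QE.
by rewrite (discrete_entropy_cell_mass D0 dY f_inj QE) esum_cell_mass_entropy.
Qed.

Theorem quantized_entropy g (L e : R) :
  log_density g -> L.-lipschitz g -> 0 < e ->
  exists2 delta : R, 0 < delta &
    forall Q Y c D f, is_density P Y g -> injective f ->
    (forall w, Q w = f (cell_index c D (Y w))) -> 0 < D <= delta ->
    ((diff_entropy g - ln D)%:E <= discrete_entropy P Q <=
     (diff_entropy g - ln D + e)%:E)%E.
Proof.
move=> dg gLip e0; have [_ g0 [M gM] _ _] := dg.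
have [delta delta_gt0 entropy_le] := diff_entropy_cell_average_le dg gLip e0.
have M1_gt0 : 0 < M + 1 by rewrite ltr_wpDl// (le_trans (g0 0)).
exists (Num.min delta (M + 1)^-1); first by rewrite lt_min delta_gt0 invr_gt0.
move=> Q Y c D f dY f_inj QE /andP[D0]; rewrite le_min => /andP[Ddelta DM].
rewrite (discrete_entropy_cell_index D0 dY dg f_inj QE) !lee_fin.
rewrite lerD2r addrAC lerD2r entropy_le ?D0// andbT.
apply: (diff_entropy_le_cell_average c D0 dg gM).
rewrite -[_^-1]mul1r ler_pdivlMr// in DM; lra.
Qed.

End quantized_entropy.

(** * Stable laws *)

Section log_moment.
Context {R : realType} {d : measure_display} {T : measurableType d}
  (P : probability T R).
Local Notation mu := (@lebesgue_measure R).

Variables (Y : {RV P >-> R}) (phi : nat -> R) (C q : R).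
Hypothesis q01 : 0 < q < 1.
Hypothesis cfY :
  forall n, (\int[P]_w (cos ((2 ^+ n)^-1 * Y w))%:E = (phi n)%:E)%E.
Hypothesis phi_le : forall n, 1 - phi n <= C * q ^+ n.

Let dyadic_term (K s : R) n w : \bar R :=
  (K * s ^+ n * (1 - cos ((2 ^+ n)^-1 * Y w)))%:E.

Let dyadic_term_ge0 K s n w : 0 <= K -> 0 <= s -> (0 <= dyadic_term K s n w)%E.
Proof.
move=> K0 s0.
by rewrite lee_fin mulr_ge0 ?subr_ge0 ?cos_le1// mulr_ge0// exprn_ge0.
Qed.

Let integrable_dyadic_cos n :
  P.-integrable [set: T] (fun w => (cos ((2 ^+ n)^-1 * Y w))%:E).
Proof. by apply: integrable_cos; exact: measurable_funM. Qed.

Let measurable_dyadic_term K s n : measurable_fun [set: T] (dyadic_term K s n).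
Proof.
apply/measurable_EFinP/measurable_funM => //; apply: measurable_funB => //.
by apply/measurable_EFinP; exact: measurable_int (integrable_dyadic_cos n).
Qed.

Let expectation_dyadic_term K s n :
  (\int[P]_w dyadic_term K s n w = (K * s ^+ n * (1 - phi n))%:E)%E.
Proof.
rewrite mulrBr mulr1 -mulNr.
rewrite -(integral_probability_affine _ _ (integrable_dyadic_cos n) (cfY n)).
by apply: eq_integral => w _; rewrite /dyadic_term mulNr mulrBr mulr1.
Qed.

Let expectation_dyadic_series_lty K s : 0 <= K -> 0 < s -> s * q < 1 ->
  (\int[P]_w (\sum_(n <oo) dyadic_term K s n w) < +oo)%E.
Proof.
move=> K0 s0 sq1; have [q0 _] := andP q01.
have term_ge0 n w := dyadic_term_ge0 n w K0 (ltW s0).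
have sq01 : 0 < s * q < 1 by rewrite mulr_gt0.
rewrite integral_nneseries//.
apply: (nneseries_geometric_lty (mulr_ge0 K0 (normr_ge0 C)) sq01) => n.
apply/andP; split; first exact: integral_ge0.
have -> : K * `|C| * (s * q) ^+ n = K * s ^+ n * (`|C| * q ^+ n).
  by rewrite exprMn; ring.
rewrite expectation_dyadic_term lee_fin ler_wpM2l
  ?mulr_ge0 ?exprn_ge0 ?(ltW s0)//.
by rewrite (le_trans (phi_le n))// ler_wpM2r ?exprn_ge0 ?ler_norm// ltW.
Qed.

Lemma expectation_ln_oneDsqr_lty :
  (\int[P]_w (ln (oneDsqr (Y w)))%:E < +oo)%E.
Proof.
have [q0 q1] := andP q01; have q1_gt0 : 0 < 1 + q by rewrite addr_gt0.
pose s := 2 / (1 + q).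
have s12 : 1 < s <= 2 by rewrite ltr_pdivlMr// ler_pdivrMr//; lra.
have s0 : 0 < s by have /andP[/(lt_trans ltr01)] := s12.
have sq1 : s * q < 1 by rewrite /s mulrAC ltr_pdivrMr//; lra.
have [K K0 ln_le] := ln_oneDsqr_le_series s12.
have term_ge0 n w := dyadic_term_ge0 n w K0 (ltW s0).
have msum :
    measurable_fun [set: T] (fun w => \sum_(n <oo) dyadic_term K s n w)%E.
  exact: (@ge0_emeasurable_sum _ _ _ setT (dyadic_term K s) xpredT
    (fun n w _ _ => term_ge0 n w)).
apply: (@le_lt_trans _ _ (\int[P]_w (1 + \sum_(n <oo) dyadic_term K s n w))%E).
  apply: ge0_le_integral => //.
  - by move=> w _; rewrite lee_fin ln_oneDsqr_ge0.
  - by apply/measurable_EFinP; exact: (measurableT_comp measurable_ln_oneDsqr).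
  - exact: emeasurable_funD.
rewrite ge0_integralD//; last by move=> w _; exact: nneseries_ge0.
rewrite integral_probability_cst lte_add_pinfty ?ltry//.
exact: expectation_dyadic_series_lty.
Qed.

Lemma integrable_ln_oneDsqr_is_density g : is_density P Y g ->
  mu.-integrable [set: R] (EFin \o (fun x => g x * ln (oneDsqr x))).
Proof.
move=> dY; have [mg [g0 _]] := dY.
have mln := @measurable_ln_oneDsqr R; have ln_ge0 := @ln_oneDsqr_ge0 R.
apply/integrableP; split; first exact/measurable_EFinP/measurable_funM.
under eq_integral do rewrite /= ger0_norm ?mulr_ge0//.
rewrite -(ge0_integral_is_density dY mln ln_ge0).
exact: expectation_ln_oneDsqr_lty.
Qed.

End log_moment.

Section stable_cf.
Context {R : realType} (alpha beta sigma drift : R).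
Hypothesis alpha0 : 0 < alpha.
Hypothesis sigma0 : 0 < sigma.
Local Notation mu := (@lebesgue_measure R).
Local Notation D := (`[0%R, +oo[%classic : set R).
Local Notation theta := (stable_f_im alpha beta sigma drift).
Implicit Types t : R.
Let s : R := sigma `^ alpha.

Definition stable_modulus t : R := expR (stable_f_re alpha sigma t).

Let s0 : 0 < s. Proof. exact: powR_gt0. Qed.

Lemma stable_modulusE t :
  0 <= t -> stable_modulus t = expR (- (s * t `^ alpha)).
Proof. by move=> t0; rewrite /stable_modulus /stable_f_re mulNr ger0_norm. Qed.

Lemma stable_f_imE t : 0 <= t ->
  theta t = t * drift + s * beta * (t `^ alpha * stable_Phi alpha t).
Proof.
rewrite /stable_f_im le_eqVlt => /predU1P[<-|t0].
  by rewrite normr0 powR0 ?gt_eqF// !(mulr0, mul0r).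
by rewrite gtr0_norm// gtr0_sg// mulr1 -/s; ring.
Qed.

Lemma measurable_stable_f_im : measurable_fun D theta.
Proof.
apply: (@eq_measurable_fun _ _ _ _ D
  (fun t => t * drift + s * beta * (t `^ alpha * stable_Phi alpha t))).
  by move=> t; rewrite inE/= in_itv/= andbT => t0; rewrite stable_f_imE.
apply: measurable_funD; first exact: measurable_funM.
apply: measurable_funM => //; apply: measurable_funM.
  by apply: measurable_funTS; exact: measurable_powR.
rewrite /stable_Phi; case: (alpha == 1) => //.
apply: measurable_funM => //; apply: measurable_funTS.
by apply: measurableT_comp; [exact: measurable_ln|exact: normr_measurable].
Qed.

Lemma measurable_stable_modulus : measurable_fun [set: R] stable_modulus.
Proof.
apply: measurableT_comp; first exact: measurable_expR.
rewrite /stable_f_re; apply: measurable_funM => //.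
by apply: (measurableT_comp (@measurable_powR R alpha));
  exact: normr_measurable.
Qed.

Lemma integrable_stable_modulus (q : R -> R) : measurable_fun D q ->
  (forall t, 0 <= t -> `|q t| <= (1 + t) * stable_modulus t) ->
  mu.-integrable D (EFin \o q).
Proof.
move=> mq q_le; have [K K0 decay] := powR_exponential_decay s0 alpha0.
have mD : (R.-ocitv.-measurable).-sigma.-measurable D by exact: measurable_itv.
have iw : mu.-integrable D (EFin \o (fun t => (oneDsqr t)^-1)).
  exact: integrableS (@integrable_oneDsqrV R).
apply: (le_integrable mD _ _ (integrableZl mD K iw));
  first exact/measurable_EFinP.
move=> t; rewrite /= in_itv/= andbT => t0; rewrite lee_fin.
rewrite (le_trans (q_le t t0))//.
rewrite ger0_norm ?mulr_ge0 ?invr_ge0 ?(ltW (oneDsqr_gt0 _))//.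
rewrite ler_pdivlMr ?oneDsqr_gt0// (le_trans _ (decay t t0))//.
rewrite -stable_modulusE// mulrAC ler_wpM2r ?expR_ge0// /oneDsqr; nra.
Qed.

Lemma integrable_stable_cf : mu.-integrable D (EFin \o stable_modulus) /\
  mu.-integrable D (fun t => (t * stable_modulus t)%:E).
Proof.
have mod_ge0 t : 0 <= stable_modulus t by exact: expR_ge0.
have mmod : measurable_fun D stable_modulus.
  by apply: measurable_funTS; exact: measurable_stable_modulus.
split; apply: integrable_stable_modulus => //.
- by move=> t t0; rewrite ger0_norm// ler_peMl// lerDl.
- exact: measurable_funM.
- by move=> t t0; rewrite ger0_norm ?mulr_ge0// ler_wpM2r// lerDr.
Qed.

Definition holder_exponent : R := Num.min 1 alpha / 2.

Let holder_exponent_gt0 : 0 < holder_exponent.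
Proof. by rewrite divr_gt0// lt_min ltr01. Qed.

Let le_powR_holder t : 0 < t <= 1 -> t <= t `^ holder_exponent.
Proof.
move=> t01; rewrite ger1_powR// ler_pdivrMr//.
have : Num.min 1 alpha <= 1 by rewrite ge_min lexx.
lra.
Qed.

Let powR_alpha_le_holder t : 0 < t <= 1 -> t `^ alpha <= t `^ holder_exponent.
Proof.
move=> t01; rewrite ger_powR// ler_pdivrMr//.
have : Num.min 1 alpha <= alpha by rewrite ge_min lexx orbT.
by have := alpha0; lra.
Qed.

Lemma powR_stable_Phi_le : exists2 F : R, 0 <= F &
  forall t, 0 < t <= 1 ->
    t `^ alpha * `|stable_Phi alpha t| <= F * t `^ holder_exponent.
Proof.
rewrite /stable_Phi /holder_exponent; have [->|alpha1] := eqVneq alpha 1.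
  have pi2_ge0 : 0 <= 2 / pi :> R by rewrite divr_ge0 ?pi_ge0.
  rewrite minxx; exists (2 / pi * 2) => [|t /andP[t0 t1]];
    first by rewrite mulr_ge0.
  rewrite powRr1 ?(ltW t0)// div1r powR12_sqrt ?(ltW t0)// (gtr0_norm t0).
  rewrite mulNr normrN normrM (ger0_norm pi2_ge0)
    mulrCA -[leRHS]mulrA ler_wpM2l//.
  by rewrite -[X in X * _](gtr0_norm t0) -normrM xlnx_le_sqrt// (ltW t0).
exists `|tan (pi * alpha / 2)| => // t t01; rewrite mulrC ler_wpM2l//.
exact: powR_alpha_le_holder.
Qed.

Lemma stable_cf_holder0 : exists2 C : R, 0 <= C & forall t, 0 < t <= 1 ->
  1 - stable_modulus t * cos (theta t) <= C * t `^ holder_exponent.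
Proof.
have [F F0 Phi_le] := powR_stable_Phi_le.
exists (s + `|drift| + s * `|beta| * F) => [|t t01].
  by rewrite !addr_ge0// ?mulr_ge0 ?(ltW s0).
have [t0 t1] := andP t01; have ta0 : 0 <= t `^ alpha by exact: powR_ge0.
have modE := stable_modulusE (ltW t0).
have mod01 : 0 <= stable_modulus t <= 1.
  by rewrite expR_ge0 modE -expR0 ler_expR oppr_le0 mulr_ge0// ltW.
have mod_near1 : 1 - stable_modulus t <= s * t `^ holder_exponent.
  have := expR_ge1Dx (- (s * t `^ alpha)); rewrite -modE.
  by have := ler_wpM2l (ltW s0) (powR_alpha_le_holder t01); lra.
have theta_le : `|theta t| <=
    `|drift| * t `^ holder_exponent +
    s * `|beta| * (F * t `^ holder_exponent).
  rewrite stable_f_imE ?(ltW t0)// (le_trans (ler_normD _ _))// !normrM.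
  rewrite (gtr0_norm t0) (gtr0_norm s0) (ger0_norm ta0) mulrC lerD//.
    by rewrite ler_wpM2l ?le_powR_holder.
  by rewrite ler_wpM2l ?Phi_le// mulr_ge0// ltW.
have cos_near1 : 1 - cos (theta t) <= `|theta t|.
  have /klipschitzP/(_ 0 (theta t)) := @cos_lipschitz R.
  by rewrite cos0 sub0r normrN mul1r; exact: le_trans (ler_norm _).
have : stable_modulus t * (1 - cos (theta t)) <= 1 - cos (theta t).
  by rewrite ler_piMl ?subr_ge0 ?cos_le1//; have /andP[] := mod01.
lra.
Qed.

Lemma stable_cf_dyadic : exists C q : R, 0 < q < 1 /\
  forall n,
    1 - stable_modulus (2 ^+ n)^-1 * cos (theta (2 ^+ n)^-1) <= C * q ^+ n.
Proof.
have [C C0 near0] := stable_cf_holder0.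
exists C, (2^-1 `^ holder_exponent); split=> [|n].
  have : 2^-1 `^ holder_exponent < 1 `^ holder_exponent :> R.
    by apply: gt0_ltr_powR; rewrite ?nnegrE// invf_lt1// ltr1n.
  by rewrite powR_gt0//= powR1.
have -> : (2^-1 `^ holder_exponent) ^+ n = (2 ^+ n)^-1 `^ holder_exponent :> R.
  by rewrite -powR_mulrn ?powR_ge0// -powRrM mulrC powRrM powR_mulrn// exprVn.
apply: near0; rewrite invr_gt0 exprn_gt0//= invf_le1 ?exprn_gt0//.
by rewrite exprn_ege1// ler1n.
Qed.

End stable_cf.

Section stable_density.
Context {R : realType} (alpha beta sigma drift : R).
Hypothesis alpha0 : 0 < alpha.
Hypothesis sigma0 : 0 < sigma.
Local Notation mu := (@lebesgue_measure R).
Local Notation rho := (stable_modulus alpha sigma).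
Local Notation theta := (stable_f_im alpha beta sigma drift).

Definition stable_density (x : R) : R := pi^-1 * osc_integral theta rho x.

Let mtheta := measurable_stable_f_im beta sigma drift alpha0.
Let irho := (integrable_stable_cf alpha0 sigma0).1.
Let itrho := (integrable_stable_cf alpha0 sigma0).2.

Lemma stable_density_bounded : exists M, forall x, stable_density x <= M.
Proof.
exists (pi^-1 * (\int[mu]_(t in `[0%R, +oo[) `|rho t|)%R) => x.
rewrite ler_wpM2l ?invr_ge0 ?pi_ge0// (le_trans (ler_norm _))//.
exact: osc_integral_bounded.
Qed.

Lemma stable_density_lipschitz : exists L : R, L.-lipschitz stable_density.
Proof.
have /klipschitzP osc_dist := osc_integral_lipschitz mtheta irho itrho.
exists (pi^-1 * (\int[mu]_(t in `[0%R, +oo[) `|t * rho t|)%R).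
apply/klipschitzP => x y; rewrite -mulrBr normrM ger0_norm ?invr_ge0 ?pi_ge0//.
by rewrite -mulrA ler_wpM2l ?invr_ge0 ?pi_ge0.
Qed.

Context {d : measure_display} {T : measurableType d} (P : probability T R).
Implicit Types (X Y : {RV P >-> R}) (n m : nat).

Lemma stable_is_density Y : has_polar_cf P Y rho theta ->
  is_density P Y stable_density.
Proof. by move=> cfY; exact: polar_cf_is_density cfY mtheta irho itrho. Qed.

Lemma stable_log_density Y : has_polar_cf P Y rho theta ->
  log_density stable_density.
Proof.
move=> cfY; have dY := stable_is_density cfY; have [mg [g0 _]] := dY.
have [C [q [q01 cf_le]]] := stable_cf_dyadic beta drift alpha0 sigma0.
split=> //; [exact: stable_density_bounded|exact: integral_is_density dY|].
apply: (integrable_ln_oneDsqr_is_density q01 _ cf_le dY) => n.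
by have [] := cfY (2 ^+ n)^-1 _.
Qed.

(* The shift [b] absorbs the failure of strict stability: [(N / n - 1) drift]
   in the generic case, and the logarithmic correction when [alpha = 1]. *)
Lemma stable_exponent_scaling n : (0 < n)%N -> exists b : R,
  forall t, 0 <= t -> let N := n%:R `^ alpha^-1 in
  expR (n%:R^-1 * stable_f_re alpha sigma (t * N)) = rho t /\
  n%:R^-1 * theta (t * N) = theta t + t * b.
Proof.
move=> n0; pose N : R := n%:R `^ alpha^-1; pose s := sigma `^ alpha.
have nR0 : (0 : R) < n%:R by rewrite ltr0n.
have N0 : 0 < N by exact: powR_gt0.
have Na : N `^ alpha = n%:R by rewrite -powRrM mulVf ?gt_eqF// powRr1// ltW.
have tNa t : 0 <= t -> (t * N) `^ alpha = t `^ alpha * n%:R.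
  by move=> t0; rewrite powRM ?(ltW N0)// Na.
exists (if alpha == 1 then s * beta * (- (2 / pi) * ln n%:R)
        else (N / n%:R - 1) * drift).
move=> t t0 /=; rewrite -/N; have tN0 : 0 <= t * N by rewrite mulr_ge0// ltW.
split.
  rewrite /stable_modulus /stable_f_re (ger0_norm t0) (ger0_norm tN0) tNa//.
  by congr expR; field; rewrite gt_eqF.
rewrite !stable_f_imE// tNa// -/s /stable_Phi.
have [a1|a1] := eqVneq alpha 1; last first.
  by field; rewrite gt_eqF.
have NE : N = n%:R by rewrite /N a1 invr1 powRr1// ltW.
move: t0; rewrite le_eqVlt => /predU1P[<-|t0].
  by rewrite a1 powRr1// !(mul0r, mulr0, add0r).
rewrite a1 powRr1 ?(ltW t0)// NE normrM.
rewrite (gtr0_norm t0) (gtr0_norm nR0) lnM ?posrE//.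
move: (ln n%:R) (2 / pi) nR0 => ln_n c; move: (n%:R : R) => r r0.
by field; rewrite gt_eqF.
Qed.

Lemma stable_rescaling n X : (0 < n)%N ->
  has_cf_exp P X n%:R^-1 alpha beta sigma drift ->
  exists (b : R) (Z : {RV P >-> R}),
    (forall w, Z w = n%:R `^ alpha^-1 * X w - b) /\
    is_density P Z stable_density.
Proof.
move=> n0 cfX; have [b bE] := stable_exponent_scaling n0.
pose N : R := n%:R `^ alpha^-1; pose affX w := N * X w - b.
have maffX : measurable_fun [set: T] affX.
  by apply: measurable_funB => //; exact: measurable_funM.
pose Z : {RV P >-> R} := HB.pack_for {mfun T >-> R} affX
  (isMeasurableFun.Build _ _ _ _ affX maffX).
exists b, Z; split=> //; apply: stable_is_density => t t0.
have cfX_polar : has_polar_cf P X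
    (fun t => expR (n%:R^-1 * stable_f_re alpha sigma t))
    (fun t => n%:R^-1 * theta t) by move=> r _; exact: cfX.
have [] := has_polar_cf_affine b (powR_ge0 _ _ : 0 <= N) cfX_polar t0.
by have [-> ->] := bE t t0; rewrite addrK.
Qed.

Lemma quantize_cell_index m (N b x : R) : (0 < m)%N -> 0 < N ->
  let D := N / m%:R in
  quantize m x = (cell_index (- D / 2 - b) D (N * x - b))%:~R / m%:R.
Proof.
move=> m0 N0 /=; have mR0 : (0 : R) < m%:R by rewrite ltr0n.
rewrite /quantize /cell_index; congr ((Num.floor _)%:~R / _).
by field; rewrite !gt_eqF.
Qed.

Lemma stable_quantized_entropy Y (e : R) :
  has_polar_cf P Y rho theta -> 0 < e ->
  exists2 delta : R, 0 < delta & forall n m X, (0 < n)%N -> (0 < m)%N ->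
    has_cf_exp P X n%:R^-1 alpha beta sigma drift ->
    n%:R `^ alpha^-1 / m%:R <= delta ->
    (`| Hmn P X m n * (n%:R^-1)%:E - (ln (m%:R / n%:R `^ alpha^-1))%:E
        - (diff_entropy stable_density)%:E | <= e%:E)%E.
Proof.
move=> cfY e0; have [L gLip] := stable_density_lipschitz.
have [delta delta_gt0 entropy_bounds] :=
  quantized_entropy P (stable_log_density cfY) gLip e0.
exists delta => // n m X n0 m0 cfX Ddelta; pose N : R := n%:R `^ alpha^-1.
have nR0 : (0 : R) < n%:R by rewrite ltr0n.
have mR0 : (0 : R) < m%:R by rewrite ltr0n.
have N0 : 0 < N by exact: powR_gt0.
have [b [Z [ZE dZ]]] := stable_rescaling n0 cfX.
pose f (k : int) : R := k%:~R / m%:R.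
have f_inj : injective f.
  by move=> j k /(mulIf (invr_neq0 (lt0r_neq0 mR0))) /intr_inj.
have QE w : quantize m (X w) =
    f (cell_index (- (N / m%:R) / 2 - b) (N / m%:R) (Z w)).
  by rewrite ZE; exact: quantize_cell_index.
have D_bounds : 0 < N / m%:R <= delta by rewrite divr_gt0.
have := entropy_bounds _ Z _ _ f dZ f_inj QE D_bounds.
rewrite /Hmn -[N / m%:R]invf_div lnV ?posrE ?divr_gt0// opprK.
move=> /andP[]; case: (discrete_entropy P _) => [H| |]//.
rewrite !lee_fin => H_ge H_le.
have -> : n%:R * H * n%:R^-1 = H by field; rewrite gt_eqF.
by rewrite ler_norml; lra.
Qed.

End stable_density.

Unset Implicit Arguments.

Theorem mainTheorem3 (R : realType) (d : measure_display) (T : measurableType d)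
  (P : probability T R) (alpha beta sigma mu : R)
  (halpha : 0 < alpha <= 2) (hbeta : -1 <= beta <= 1) (hsigma : 0 < sigma)
  (X1 : nat -> {RV P >-> R}) (X0 : {RV P >-> R})
  (hX1 : forall n : nat, (0 < n)%N ->
          has_cf_exp P (X1 n) (n%:R)^-1 alpha beta sigma mu)
  (hX0 : has_cf_exp P X0 1 alpha beta sigma mu)
  (mf : nat -> nat)
  (hmf : (fun n : nat => (mf n)%:R / (n%:R `^ alpha^-1)) @ \oo --> +oo) :
  exists g : R -> R,
    is_density P X0 g /\
    lebesgue_measure.-integrable [set: R] (fun x => (g x * ln (g x))%:E) /\
    (fun n : nat =>
       ereal_sup [set `| Hmn P (X1 n) m n * (n%:R^-1)%:E
                         - (ln (m%:R / (n%:R `^ alpha^-1)))%:E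
                         - (diff_entropy g)%:E |%E
                 | m in [set m : nat | (mf n <= m)%N]]) @ \oo --> 0%E.
Proof.
have [alpha0 _] := andP halpha.
have cfX0 : has_polar_cf P X0 (stable_modulus alpha sigma)
    (stable_f_im alpha beta sigma mu).
  by move=> t _; have := hX0 t; rewrite !mul1r.
have dX0 := stable_log_density alpha0 hsigma cfX0.
exists (stable_density alpha beta sigma mu); split.
  exact: stable_is_density.
split; first exact: log_density_integrable_xlnx.
apply: cvg_ereal_sup0 => [n _ [m _ <-]|n|e e0]; first exact: abse_ge0.
  by eexists; exists (mf n) => //=.
have [delta delta_gt0 error_le] :=
  stable_quantized_entropy alpha0 hsigma cfX0 e0.
have N0 : \forall n \near \oo, 0 < n%:R `^ alpha^-1 :> R.
  by near=> n; rewrite powR_gt0// ltr0n; near: n; exact: nbhs_infty_gt.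
near=> n => _ [m /= mfm <-].
have [m0 D_le] : (0 < m)%N /\ n%:R `^ alpha^-1 / m%:R <= delta.
  by move: m mfm; near: n; exact: near_divr_natr_le.
have n0 : (0 < n)%N by near: n; exact: nbhs_infty_gt.
by apply: error_le => //; exact: hX1.
Unshelve. all: by end_near. Qed.
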